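(* Assume the following. (Boundedness) There exist constants $C,C'>0$ such that for every $\theta\in\Theta$: the $\mathcal G_t^\theta$-intensity $\boldsymbol\lambda^\theta$ of $N^\theta$ is càglàd with $\sup_{0\le t\le 1}\boldsymbol\lambda_t^\theta\le C$ almost surely; the residual process $G^\theta$ is càglàd with $\sup_{0\le t\le 1}|G_t^\theta|\le C'$ almost surely; and the estimators satisfy the same bounds, $\sup_t|\hat\lambda_t^{(n),\theta}|\le C$ and $\sup_t|\hat G_t^{(n),\theta}|\le C'$ almost surely. (Rates) $|J_n|\to\infty$ as $n\to\infty$, and with $g^\theta(n)=\||G^\theta-\hat G^{(n),\theta}\||_2$ and $h^\theta(n)=\||\lambda^\theta-\hat\lambda^{(n),\theta}\||_2$, $$\lim_{n\to\infty}\sup_{\theta\in\Theta}\max\{g^\theta(n),\,h^\theta(n),\,\sqrt{|J_n|}\,g^\theta(n)h^\theta(n)\}=0 .$$ Then $\sup_{t\in[0,1]}|\hat{\mathcal V}_n^\theta(t)-\mathcal V^\theta(t)|\xrightarrow{P/\Theta}0$ as $n\to\infty$, i.e. for every $\epsilon>0$, $$\lim_{n\to\infty}\sup_{\theta\in\Theta}\mathbb P\Big(\sup_{t\in[0,1]}|\hat{\mathcal V}_n^\theta(t)-\mathcal V^\theta(t)|>\epsilon\Big)=0 .$$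
   Context: Setting. $\Theta$ is an arbitrary set indexing sampling distributions; every object below depends on $\theta\in\Theta$, with the superscript $\theta$ often suppressed. Time is $[0,1]$. $N$ is a counting process adapted to a right-continuous complete filtration $\mathcal F_t$; $X$ is a real-valued càglàd process; $\mathcal G_t$ is the right-continuous complete filtration generated by $\mathcal F_t$ and $X_t$. $N$ has an $\mathcal F_t$-intensity $\lambda$ (i.e. $\lambda$ is $\mathcal F_t$-predictable and $N_t-\int_0^t\lambda_s\,ds$ is a local $\mathcal F_t$-martingale) and a $\mathcal G_t$-intensity $\boldsymbol\lambda$. A residual process $G$ of $X$ given $\mathcal F_t$ is a càglàd $\mathcal G_t$-adapted process with $E(G_t\mid\mathcal F_{t-})=0$ for all $t\in[0,1]$; one is fixed for each $\theta$. The variance function is $\mathcal V(t)=E\int_0^tG_s^2\,dN_s$. Data and estimators. $(N_j,X_j,\mathcal F_j)$, $j=1,\dots,n$, are i.i.d. replications of $(N,X,\mathcal F)$. $J_n\cup J_n^c=\{1,\dots,n\}$ is a partition into two disjoint sets. The estimates $\hat\lambda^{(n)}$ and $\hat G^{(n)}$ are fitted on data indexed by $J_n^c$ only; given those data they are fixed maps, evaluated on the $\mathcal F$-history resp. $\mathcal G$-history of a new observation, yielding (conditionally on the training data) an $\mathcal F_t$-predictable process resp. a $\mathcal G_t$-predictable process. $\hat\lambda_j^{(n)},\hat G_j^{(n)}$ are their evaluations on observation $j\in J_n$; $\hat\lambda_t^{(n)},\hat G_t^{(n)}$ are their evaluations on one additional copy $(N,X,\mathcal F)$ independent of the data. The variance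 estimator is $$\hat{\mathcal V}_n(t)=\frac1{|J_n|}\sum_{j\in J_n}\int_0^t(\hat G_{j,s}^{(n)})^2\,dN_{j,s}.$$ For a process $W$ on $[0,1]$, $\||W\||_2^2=E\int_0^1W_s^2\,ds$. *)

(* Defs.v *)
From HB Require Import structures.
From mathcomp Require Import all_boot all_order all_algebra.
From mathcomp Require Import all_classical all_reals all_analysis.

Set Implicit Arguments.
Unset Strict Implicit.
Unset Printing Implicit Defensive.

Import Order.TTheory GRing.Theory Num.Theory.
Import numFieldNormedType.Exports.

Local Open Scope classical_set_scope.
Local Open Scope ring_scope.

(* A real process on a space [S] is a map [R -> S -> R], time first.  Only the
   times in [0, 1] matter. *)

Definition caglad (R : realType) (f : R -> R) : Prop :=
  (forall t, 0 < t <= 1 -> f x @[x --> t^'-] --> f t) /\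
  (forall t, 0 <= t < 1 -> cvg (f x @[x --> t^'+])).

Definition caglad_process (R : realType) (S : Type) (Y : R -> S -> R) : Prop :=
  forall w, caglad (Y ^~ w).

(* A sub-sigma-algebra of [S] is given by its set of events; a filtration is a
   family of such sets indexed by time. *)

Definition right_lim (R : realType) (S : Type) (H : R -> set (set S)) (t : R)
    : set (set S) :=
  if t < 1 then \bigcap_(s in [set s | t < s <= 1]) H s else H 1.

(* The sigma-algebra at time t-, with the usual convention H_{0-} = H_0. *)
Definition left_lim (R : realType) (S : Type) (H : R -> set (set S)) (t : R)
    : set (set S) :=
  if 0 < t then <<s \bigcup_(s in [set s | 0 <= s < t]) H s >> else H 0.

(* The last two fields are the usual conditions.  As [H 0] consists of
   measurable sets, completeness forces [S] to be complete for [Q]. *)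
Record usual_filtration (R : realType) (d : measure_display)
    (S : measurableType d) (Q : probability S R) (H : R -> set (set S))
    : Prop := {
  filtration_sigma : forall t, 0 <= t <= 1 -> sigma_algebra setT (H t) ;
  filtration_sub : forall t, 0 <= t <= 1 -> H t `<=` measurable ;
  filtration_mono : forall s t, 0 <= s -> s <= t -> t <= 1 -> H s `<=` H t ;
  filtration_right : forall t, 0 <= t <= 1 -> H t = right_lim H t ;
  filtration_complete : forall A : set S, Q.-negligible A -> H 0 A
}.

(* Completing and taking right limits yields the smallest filtration satisfying
   the usual conditions that contains [F] and makes [X] adapted. *)
Definition enlarge (R : realType) (d : measure_display) (S : measurableType d)
    (Q : probability S R) (F : R -> set (set S)) (X : R -> S -> R)
    : R -> set (set S) :=
  right_lim (fun s =>
    <<s F s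
        `|` \bigcup_(u in [set u | 0 <= u <= s])
              preimage_set_system setT (X u) measurable
        `|` [set A | Q.-negligible A] >>).

Definition measurable_wrt (R : realType) (S : Type) (H : set (set S))
    (f : S -> R) : Prop :=
  forall B : set R, measurable B -> H (f @^-1` B).

Definition adapted (R : realType) (S : Type) (H : R -> set (set S))
    (Y : R -> S -> R) : Prop :=
  forall t, 0 <= t <= 1 -> measurable_wrt (H t) (Y t).

(* Subsets of [0, 1] x S, generated by the predictable rectangles. *)
Definition predictable_sigma (R : realType) (S : Type) (H : R -> set (set S))
    : set (set (R * S)) :=
  <<s `[0, 1] `*` setT,
      [set E | exists2 A, H 0 A & E = [set 0] `*` A]
      `|` [set E | exists s t A,
             [/\ 0 <= s, s < t, t <= 1, H s A & E = `]s, t] `*` A]] >>.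

Definition predictable (R : realType) (S : Type) (H : R -> set (set S))
    (Y : R -> S -> R) : Prop :=
  forall B : set R, measurable B ->
    predictable_sigma H
      ((`[0, 1] `*` setT) `&` [set p : R * S | B (Y p.1 p.2)]).

(* [Z] is a version of E(Y | H). *)
Definition is_cond_exp (R : realType) (d : measure_display)
    (S : measurableType d) (Q : probability S R) (H : set (set S))
    (Y Z : S -> R) : Prop :=
  [/\ Q.-integrable setT (EFin \o Y),
      Q.-integrable setT (EFin \o Z),
      measurable_wrt H Z &
      forall A, H A ->
        (\int[Q]_(w in A) (Y w)%:E = \int[Q]_(w in A) (Z w)%:E)%E].

Definition martingale (R : realType) (d : measure_display)
    (S : measurableType d) (Q : probability S R) (H : R -> set (set S))
    (M : R -> S -> R) : Prop :=
  [/\ adapted H M,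
      (forall t, 0 <= t <= 1 -> Q.-integrable setT (EFin \o M t)) &
      forall s t, 0 <= s -> s <= t -> t <= 1 ->
        is_cond_exp Q (H s) (M t) (M s)].

Definition stopping_time (R : realType) (S : Type) (H : R -> set (set S))
    (tau : S -> R) : Prop :=
  (forall w, 0 <= tau w) /\
  (forall t, 0 <= t <= 1 -> H t [set w | tau w <= t]).

(* On the time set [0, 1] a localizing sequence has to reach 1 after finitely
   many steps, almost surely. *)
Definition local_martingale (R : realType) (d : measure_display)
    (S : measurableType d) (Q : probability S R) (H : R -> set (set S))
    (M : R -> S -> R) : Prop :=
  exists tau : nat -> S -> R,
    [/\ forall k, stopping_time H (tau k),
        {ae Q, forall w, (forall k, tau k w <= tau k.+1 w) /\
                         exists k, 1 <= tau k w} &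
        forall k, martingale Q H (fun t w => M (Num.min t (tau k w)) w)].

(* The paths of a counting process are taken in [cumulative R R]
   (nondecreasing, right-continuous on the line), so that dN is the library's
   Lebesgue-Stieltjes measure.  A path on [0, 1] extends to the line as a
   constant on either side, and only ]0, 1] is ever integrated over. *)

Definition path_process (R : realType) (S : Type) (N : S -> cumulative R R)
    : R -> S -> R := fun t w => N w t.

Record counting_process (R : realType) (S : Type) (N : S -> cumulative R R)
    : Prop := {
  counting0 : forall w, N w 0 = 0 ;
  counting_nat : forall w t, 0 <= t <= 1 -> exists k : nat, N w t = k%:R ;
  counting_jump : forall w t, 0 < t <= 1 ->
    (N w x @[x --> t^'-] --> N w t) \/ (N w x @[x --> t^'-] --> N w t - 1)
}.

Definition integral_dN (R : realType) (f : R -> R) (n : cumulative R R) (t : R)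
    : \bar R :=
  (\int[lebesgue_stieltjes_measure n]_(s in `]0%R, t]) (f s)%:E)%E.

(* Almost sure integrability of the paths is what makes the integral in the
   compensated process meaningful. *)
Definition is_intensity (R : realType) (d : measure_display)
    (S : measurableType d) (Q : probability S R) (H : R -> set (set S))
    (N : S -> cumulative R R) (l : R -> S -> R) : Prop :=
  [/\ predictable H l,
      {ae Q, forall w, (@lebesgue_measure R).-integrable `[0, 1]
                         (fun s => (l s w)%:E)} &
      local_martingale Q H
        (fun t w => N w t - \int[lebesgue_measure]_(s in `[0, t]) l s w)].

Definition residual_process (R : realType) (d : measure_display)
    (S : measurableType d) (Q : probability S R) (F : R -> set (set S))
    (X G : R -> S -> R) : Prop :=
  [/\ caglad_process G,
      adapted (enlarge Q F X) G &
      forall t, 0 <= t <= 1 -> is_cond_exp Q (left_lim F t) (G t) (cst 0)].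

Definition variance_function (R : realType) (d : measure_display)
    (S : measurableType d) (Q : probability S R) (N : S -> cumulative R R)
    (G : R -> S -> R) (t : R) : \bar R :=
  (\int[Q]_w integral_dN (fun s => (G s w ^+ 2)%R) (N w) t)%E.

Definition process_norm2 (R : realType) (d : measure_display)
    (S : measurableType d) (P : probability S R) (W : R -> S -> R) : \bar R :=
  ((\int[P]_w \int[lebesgue_measure]_(s in `[0%R, 1%R]) (W s w ^+ 2)%:E)
     `^ 2^-1%R)%E.

(* [S] with law [Q] carries one observation (N, X, F).  Replications are i.i.d.
   random elements [Z 0, Z 1, ...] of [S] with law [Q]: the j-th one is
   (N o Z j, X o Z j, (Z j)^-1 F).  The data are [Z 1, ..., Z n], and [Z 0] is
   the additional copy. *)

Definition iid_elements (R : realType) (dO d : measure_display)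
    (Om : measurableType dO) (S : measurableType d) (P : probability Om R)
    (Q : probability S R) (Z : nat -> Om -> S) : Prop :=
  [/\ forall j, measurable_fun setT (Z j),
      forall j (A : set S), measurable A -> P (Z j @^-1` A) = Q A &
      forall (m : nat) (A : nat -> set S), (forall j, measurable (A j)) ->
        P (\bigcap_(j < m) (Z j @^-1` A j))
        = (\prod_(j < m) P (Z j @^-1` A j))%E].

(* The index j : 'I_n stands for the observation [Z j.+1]. *)
Definition training (Om S : Type) (Z : nat -> Om -> S) (n : nat)
    (J : {set 'I_n}) (w : Om) : #|~: J|.-tuple S :=
  [tuple Z (enum_val i).+1 w | i < #|~: J|].

(* A fitting procedure turns m training observations into a process on [S].
   Joint measurability, training data included, is what gives a meaning to
   expectations over both the training data and the new observation. *)
Definition predictable_estimator (R : realType) (d : measure_display)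
    (S : measurableType d) (H : R -> set (set S)) (m : nat)
    (f : m.-tuple S -> R -> S -> R) : Prop :=
  measurable_fun [set p : m.-tuple S * R * S | 0 <= p.1.2 <= 1]
    (fun p => f p.1.1 p.1.2 p.2) /\
  (forall x, predictable H (f x)).

Definition evaluate (R : realType) (Om S : Type) (Z : nat -> Om -> S) (n : nat)
    (J : {set 'I_n}) (f : #|~: J|.-tuple S -> R -> S -> R) (j : nat)
    : R -> Om -> R :=
  fun t w => f (training Z J w) t (Z j w).

Definition variance_estimator (R : realType) (Om S : Type)
    (Z : nat -> Om -> S) (N : S -> cumulative R R) (n : nat) (J : {set 'I_n})
    (ghat : #|~: J|.-tuple S -> R -> S -> R) (t : R) (w : Om) : \bar R :=
  ((#|J|%:R^-1)%:E *
   \sum_(j in J) integral_dN (fun s => (evaluate Z ghat j.+1 s w ^+ 2)%R)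
                   (N (Z j.+1 w)) t)%E.

(* Main.v *)
Require Import Defs.
From HB Require Import structures.
From mathcomp Require Import all_boot all_order all_algebra.
From mathcomp Require Import all_classical all_reals all_analysis.
From mathcomp Require Import measurable_realfun ring lra.

(* The intensity of [N] and its estimate play no role.  With [G'] the truncation
   of [G] at [C'], which is almost surely [G] itself, compare the estimator with
   the empirical mean of the paths [int_0^t G'^2 dN_j].

   For a nonnegative predictable [f], [E int f dN <= C E int f ds]: it holds on
   predictable rectangles by stopping the compensated process and monotone
   convergence, hence for all [f] by a pi-lambda argument.  Conditionally on the
   training data this bounds the mean of [int |ghat^2 - G'^2| dN_j], which does
   not depend on [t], by [2 C C'] times the L2-distance between [ghat] and [G].

   Since [N_1^2 <= 2 int N dN] and [N_s - 1] is dominated by the left-continuous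
   [N_{s-}], the same inequality gives [N_1] a second moment, so that Chebyshev's
   inequality controls the empirical mean at finitely many times, uniformly in
   [theta].  As the paths are nondecreasing and the variance function is
   Lipschitz with constant [C C'^2], a finite grid controls all times.

   Integrals against [dN] are handled by the generalized inverse [T] of the path,
   [int_]0, t] f dN = int_]0, N_t] f (T y) dy], which makes their measurability
   in the random outcome a matter of Fubini's theorem.  The event in the theorem
   has to be shown measurable, as the library's measures carry no information
   outside their sigma-algebra. *)

Set Implicit Arguments.
Unset Strict Implicit.
Unset Printing Implicit Defensive.

Import Order.TTheory GRing.Theory Num.Theory.
Import numFieldNormedType.Exports.

Local Open Scope classical_set_scope.
Local Open Scope ring_scope.

(** * Stieltjes integrals through the generalized inverse of the path *)

(** Two obstacles shape the estimate of $E\int f\,dN$ by $C\,E\int f\,ds$. The compensated process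
    is only a local martingale, and nothing says in advance that [N w 1] is integrable. Moreover an
    inequality between measures does not pass from a pi-system to the sigma-algebra it generates; an
    equality of finite measures does. Both are overcome by adding the slack $(C-l)\,dt$ to $dN$: the
    sum has nonnegative increments, so monotone convergence removes the stopping, and on predictable
    sets its measure equals that of $C\,dt$, so uniqueness of measures applies. Dropping the slack
    at the very end gives the inequality. The bound on [ghat] is given along [Z 0] only. It is
    therefore used only after a $dN$-integral along [Z j] has been exchanged for a $dt$-integral
    along [Z 0]; until then integrals of [ghat] may be infinite and are compared additively. *)

Section generalized_inverse.
Context {R : realType}.
Implicit Types (n : cumulative R R) (t y : R).

(** The default value 0 lies outside ]0, 1], so it never contributes to an integral over that
    interval. *)
Definition ginv (n : R -> R) (y : R) : R :=
  if 0 < y <= n 1 then inf [set t | 0 <= t <= 1 /\ y <= n t] else 0.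

(** Right-continuity makes the infimum a minimum, whence this Galois connection. If [n t < y], then
    [n] stays below [y] a little beyond [t], where the infimum would already have been passed. *)
Lemma ginv_le n t y : 0 < y <= n 1 -> 0 <= t <= 1 ->
  (ginv n y <= t) = (y <= n t).
Proof.
move=> yn t01; rewrite /ginv yn.
set A := [set _ | _].
have A1 : A 1 by split; rewrite ?ler01 ?lexx//; case/andP: yn.
have Alb : has_lbound A by exists 0 => s [/andP[]].
apply/idP/idP => [le_t|ynt]; last by apply: inf_lbound.
rewrite leNgt; apply/negP => nty.
have e0 : 0 < (y - n t) / 2 by lra.
have [d nd] := nondecreasing_right_continuousP t n e0.
have tlt : inf A < t + d%:num by rewrite (le_lt_trans le_t)// ltrDl.
have [s [s01 yns] st] := inf_lt (ex_intro _ 1 A1) tlt.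
have := le_trans yns (cumulative_is_nondecreasing n _ _ (ltW st)).
by move=> /le_trans/(_ nd); lra.
Qed.

Lemma ginv_ge0_le1 n y : 0 <= ginv n y <= 1.
Proof.
rewrite /ginv; case: ifPn => [yn|_]; last by rewrite lexx ler01.
set A := [set _ | _].
have A1 : A 1 by split; rewrite ?ler01 ?lexx//; case/andP: yn.
have Alb : has_lbound A by exists 0 => s [/andP[]].
apply/andP; split; last exact: inf_lbound.
by apply: lb_le_inf; [exists 1|move=> s [/andP[]]].
Qed.

Lemma le_cumulative_ginv n y : 0 < y <= n 1 -> y <= n (ginv n y).
Proof. by move=> yn; rewrite -ginv_le// ginv_ge0_le1. Qed.

(** For $0\le r<1$ the event that the inverse exceeds $r$ is the difference of $0<y\le N_1$ and
    $0<y\le N_r$, so measurability of [N] at fixed times gives joint measurability in $(y,w)$. *)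
Lemma measurable_ginv d (S : measurableType d) (N : S -> cumulative R R) :
  (forall t, 0 <= t <= 1 -> measurable_fun setT (fun w => N w t)) ->
  measurable_fun setT (fun p : measurableTypeR R * S =>
    ginv (N p.2) p.1 : measurableTypeR R).
Proof.
move=> mN.
have mN2 t : 0 <= t <= 1 -> measurable_fun setT (fun p : measurableTypeR R * S => N p.2 t).
  by move=> t01; apply: (measurableT_comp (mN _ t01)).
have mle t : 0 <= t <= 1 -> measurable [set p : measurableTypeR R * S | 0 < p.1 <= N p.2 t].
  move=> t01; rewrite (_ : [set _ | _] =
    (fun p : measurableTypeR R * S => (0 < p.1) && (p.1 <= N p.2 t)) @^-1` [set true])//.
  rewrite -[X in measurable X]setTI; apply: measurable_and => //.
  - by apply: measurable_fun_ltr.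
  - by apply: measurable_fun_ler => //; exact: mN2.
apply: (measurability (@RGenOInfty.G R)) => [|/= _ [_] [r] -> <-].
  exact: RGenOInfty.measurableE.
rewrite setTI.
have [r0|r0] := ltP r 0.
  rewrite [X in measurable X](_ : _ = setT)//.
  apply/seteqP; split => // p _ /=; rewrite in_itv/= andbT.
  by rewrite (lt_le_trans r0)//; case/andP: (ginv_ge0_le1 (N p.2) p.1).
have [r1|r1] := leP 1 r.
  rewrite [X in measurable X](_ : _ = set0)//.
  apply/seteqP; split => // p /=; rewrite in_itv/= andbT ltNge => /negP; apply.
  by rewrite (le_trans _ r1)//; case/andP: (ginv_ge0_le1 (N p.2) p.1).
have r01 : 0 <= r <= 1 by rewrite r0 ltW.
rewrite [X in measurable X](_ : _ = [set p | 0 < p.1 <= N p.2 1] `\`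
    [set p | 0 < p.1 <= N p.2 r]); last first.
  apply/seteqP; split => [p|p []]/=; rewrite in_itv/= andbT.
    move=> rg; have pN : 0 < p.1 <= N p.2 1.
      move: rg; rewrite /ginv; case: ifPn => // _.
      by rewrite ltNge r0.
    by split=> // /andP[_]; rewrite -ginv_le// leNgt rg.
  by move=> pN /negP; rewrite (proj1 (andP pN))/= -ginv_le// -ltNge.
by apply: measurableD; apply: mle; rewrite // ler01 lexx.
Qed.

Lemma measurable_ginv1 n :
  measurable_fun setT (ginv n : measurableTypeR R -> measurableTypeR R).
Proof.
have := @measurable_ginv _ R (fun=> n) (fun t _ => measurable_cst _).
move=> mg; rewrite (_ : ginv n =
  (fun p : measurableTypeR R * R => ginv n p.1) \o (fun y => (y, 0))) //.
by apply: (measurableT_comp mg); exact: measurable_pair2.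
Qed.

End generalized_inverse.

Section pushmeasure.
Context d d' (T1 : measurableType d) (T2 : measurableType d') (R : realFieldType).

Definition pushmeasure (m : {measure set T1 -> \bar R}) (f : T1 -> T2)
    (mf : measurable_fun setT f) : {measure set T2 -> \bar R} :=
  measure_function_pushforward__canonical__measure_function_Measure m mf.

End pushmeasure.

Section stieltjes_integral.
Context {R : realType} (n : cumulative R R).
Hypothesis n0 : n 0 = 0.

Lemma preimage_ginv (a b : R) : 0 <= a -> b <= 1 -> a <= b ->
  ginv n @^-1` `]a, b]%classic = `]n a, n b]%classic.
Proof.
move=> a0 b1 ab.
have a01 : 0 <= a <= 1 by rewrite a0 (le_trans ab).
have b01 : 0 <= b <= 1 by rewrite (le_trans a0).
have na0 : 0 <= n a by rewrite -n0; exact: cumulative_is_nondecreasing.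
have nb1 : n b <= n 1 by exact: cumulative_is_nondecreasing.
apply/seteqP; split=> y /=; rewrite !in_itv/=.
  move=> /andP[ay yb]; have yn : 0 < y <= n 1.
    by move: ay; rewrite {1}/ginv; case: ifPn => // _ /lt_geF; rewrite a0.
  by rewrite -ginv_le// yb ltNge -ginv_le// -ltNge ay.
move=> /andP[ay yb]; have yn : 0 < y <= n 1.
  by rewrite (le_lt_trans na0)//= (le_trans yb).
by rewrite ltNge ginv_le// -ltNge ay/= ginv_le.
Qed.

Lemma stieltjes_ocitv (a b : R) : a <= b ->
  lebesgue_stieltjes_measure n `]a, b]%classic = (n b - n a)%:E.
Proof.
move=> ab; rewrite -(wlength_itv_bnd n false false ab).
exact/measurable_mu_extE/is_ocitv.
Qed.

(** Both measures are first restricted to ]0, 1], since [n] is arbitrary elsewhere and the default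
    values of [ginv] pile up at 0. The restrictions agree on half-open intervals, a generating
    pi-system. *)
Lemma stieltjes_pushforward (A : set R) : measurable A ->
  A `<=` `]0, 1]%classic ->
  lebesgue_stieltjes_measure n A = pushforward lebesgue_measure (ginv n) A.
Proof.
move=> mA A01.
have n1 : 0 <= n 1 by rewrite -n0; exact: cumulative_is_nondecreasing.
have mD : measurable (`]0, 1]%classic : set (measurableTypeR R)).
  exact: measurable_itv.
pose m1 : {measure set (measurableTypeR R) -> \bar R} := mrestr (lebesgue_stieltjes_measure n) mD.
have mg : measurable_fun setT (ginv n : measurableTypeR R -> measurableTypeR R).
  exact: measurable_ginv1.
pose m2 : {measure set (measurableTypeR R) -> \bar R} :=
  mrestr (pushmeasure lebesgue_measure mg) mD.
suff : m1 A = m2 A by rewrite /m1 /m2 /= /mrestr !setIidl.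
have E (a b : R) : (m1 `]a, b]%classic = m2 `]a, b]%classic) /\
    (m1 `]a, b]%classic < +oo)%E.
  rewrite /m1 /m2 /= /mrestr.
  have -> : `]a, b]%classic `&` `]0, 1]%classic =
      `]Num.max a 0, Num.min b 1]%classic :> set R.
    apply/seteqP; split => x /=; rewrite !in_itv/= gt_max le_min.
      by case=> /andP[-> ->] /andP[-> ->].
    by move=> /andP[/andP[-> ->] /andP[-> ->]].
  have [ba|ab] := ltP (Num.min b 1) (Num.max a 0).
    by rewrite set_itv_ge ?measure0 ?ltry// bnd_simp -leNgt ltW.
  have na : n (Num.max a 0) <= n (Num.min b 1) by exact: cumulative_is_nondecreasing.
  rewrite stieltjes_ocitv// /= /pushforward preimage_ginv//.
  - rewrite lebesgue_measure_itv/= lte_fin ltry; split=> //.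
    by case: ltgtP na => // -> _; rewrite subrr.
  - by rewrite le_max lexx orbT.
  - by rewrite ge_min lexx orbT.
apply: (@measure_unique _ R (measurableTypeR R) (@ocitv R)
  (fun k => `](- k%:R), k%:R]%classic) _ _ _ _ m1 m2).
- by [].
- exact: ocitvI.
- by move=> k; exact: is_ocitv.
- by rewrite -(bigcup_itvT false false).
- by move=> _ [x _ <-]; exact: (E x.1 x.2).1.
- by move=> k; exact: (E _ _).2.
- exact: mA.
Qed.

Lemma stieltjes_integral_ginv (a b : R) (f : R -> \bar R) :
  0 <= a -> a <= b -> b <= 1 ->
  measurable_fun `]a, b]%classic f -> (forall s, 0 <= f s)%E ->
  (\int[lebesgue_stieltjes_measure n]_(s in `]a, b]) f s =
   \int[lebesgue_measure]_(y in `]n a, n b]) f (ginv n y))%E.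
Proof.
move=> a0 ab b1 mf f0.
have mg : measurable_fun setT (ginv n : measurableTypeR R -> measurableTypeR R).
  exact: measurable_ginv1.
rewrite (@eq_measure_integral _ _ _ _ (pushmeasure lebesgue_measure mg)).
  rewrite (ge0_integral_pushforward mg)//.
  by rewrite preimage_ginv.
move=> A mA Aab; apply: stieltjes_pushforward => //.
apply: subset_trans Aab _ => x /=; rewrite !in_itv/= => /andP[ax xb].
by rewrite (le_lt_trans a0 ax) (le_trans xb b1).
Qed.

End stieltjes_integral.

(** Replacing the functions by zero on the exceptional set leaves all integrals unchanged. The form
    is dictated by the compensator, whose paths behave well only almost surely. *)
Lemma ae_monotone_convergence d (T : measurableType d) (R : realType)
    (mu : {measure set T -> \bar R}) (D : set T) (f_ : (T -> \bar R)^nat)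
    (f : T -> \bar R) :
  measurable D -> (forall k, measurable_fun D (f_ k)) -> measurable_fun D f ->
  {ae mu, forall x, D x -> [/\ forall k, (0 <= f_ k x)%E,
      nondecreasing_seq (f_ ^~ x) & f_ ^~ x @ \oo --> f x]} ->
  (\int[mu]_(x in D) f_ k x)%E @[k --> \oo] --> (\int[mu]_(x in D) f x)%E.
Proof.
move=> mD mf_ mf [A [mA muA0 AE]].
have good x : D x -> ~ A x -> [/\ forall k, (0 <= f_ k x)%E,
      nondecreasing_seq (f_ ^~ x) & f_ ^~ x @ \oo --> f x].
  by move=> Dx Ax; move: Dx; apply: contrapT => bad; apply: Ax; exact: AE.
have mDA : measurable (D `\` A) by exact: measurableD.
have E g : measurable_fun D g ->
    (\int[mu]_(x in D) g x = \int[mu]_(x in D) (g \_ (~` A)) x)%E.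
  move=> mg; apply: ae_eq_integral => //.
    apply/measurable_restrict => //; first exact: measurableC.
    apply: measurable_funS mg => //; exact: subIsetl.
  exists A; split=> // x /= /not_implyP[Dx gx]; apply: contrapT => nAx.
  by apply: gx; rewrite patchE mem_set.
rewrite (E _ mf); under eq_fun do rewrite E//.
have -> : (\int[mu]_(x in D) (f \_ (~` A)) x =
    \int[mu]_(x in D) (limn (fun k => (f_ k \_ (~` A)) x)))%E.
  apply: eq_integral => x /set_mem Dx; apply/esym/cvg_lim => //.
  rewrite /patch; case: ifPn => [/set_mem nAx|_]; last exact: cvg_cst.
  by have [] := good x Dx nAx.
apply: cvg_monotone_convergence => //.
- move=> k; apply/measurable_restrict => //; first exact: measurableC.
  apply: measurable_funS (mf_ k) => //; exact: subIsetl.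
- move=> k x Dx; rewrite /patch; case: ifPn => // /set_mem nAx.
  by have [] := good x Dx nAx.
- move=> x Dx i j ij; rewrite /patch; case: ifPn => // /set_mem nAx.
  by have [_ + _] := good x Dx nAx; apply.
Qed.

Section path_compensator.
Context {R : realType} (l : R -> R) (C : R).
Hypothesis il : (@lebesgue_measure R).-integrable `[0, 1] (fun s => (l s)%:E).
Hypothesis lC : forall t, 0 <= t <= 1 -> l t <= C.
Local Notation L t := (\int[lebesgue_measure]_(s in `[0, t]) l s).

(** The positive part gives the left side a meaning and a sign on every path; on a path satisfying
    [lC] it has no effect, and the right side is the increment of $Ct-L_t$. *)
Lemma path_compensator (a b : R) : 0 <= a -> a <= b -> b <= 1 ->
  (\int[lebesgue_measure]_(s in `]a, b]) (Num.max (C - l s) 0)%:E)%E =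
  (C * (b - a) - (L b - L a))%:E.
Proof.
move=> a0 ab b1.
have ab01 : (`]a, b]%classic : set R) `<=` `[0, 1]%classic.
  move=> x /=; rewrite !in_itv/= => /andP[ax xb].
  by rewrite (le_trans a0 (ltW ax)) (le_trans xb).
have il_ab : (@lebesgue_measure R).-integrable `]a, b] (EFin \o l).
  exact: integrableS il.
have il_0b : (@lebesgue_measure R).-integrable `[0, b] (EFin \o l).
  by apply: integrableS il => //; apply: subset_itvl; rewrite bnd_simp.
rewrite Rintegral_itvB ?bnd_simp//.
have -> : (\int[lebesgue_measure]_(s in `]a, b]) (Num.max (C - l s) 0)%:E)%E =
  (\int[lebesgue_measure]_(s in `]a, b]) (EFin \o (fun s => C - l s)%R) s)%E.
  apply: eq_integral => s /set_mem/ab01/=; rewrite in_itv/= => /lC lsC.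
  by rewrite max_l// subr_ge0.
have iC : (@lebesgue_measure R).-integrable `]a, b] (EFin \o (fun=> C)).
  apply: measurable_bounded_integrable => //.
    by rewrite /= lebesgue_measure_itv/=; case: ifPn => // _; rewrite ltry.
  exact: bounded_cst.
rewrite -[LHS]fineK; last first.
  apply: integrable_fin_num => //.
  exact: (integrableB _ iC il_ab).
congr EFin; rewrite -/(Rintegral _ _ _) RintegralB// Rintegral_cst//.
congr (C * _ - _).
rewrite /= lebesgue_measure_itv/=; case: ifPn => //.
by rewrite lte_fin; case: ltgtP ab => // ->; rewrite subrr.
Qed.

End path_compensator.

(** * Tonelli's theorem for $dN_s(w)\,Q(dw)$ and for products *)

Section stieltjes_tonelli.
Context {R : realType} d (S : measurableType d) (N : S -> cumulative R R).
Local Notation TR := (measurableTypeR R).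
Hypothesis N0 : forall w, N w 0 = 0.
Hypothesis mN : forall t, 0 <= t <= 1 -> measurable_fun setT (fun w => N w t).

Let Phi (p : TR * S) : TR * S := (ginv (N p.2) p.1, p.2).

Lemma measurable_ginv_pair :
  measurable_fun setT
    (fun p : TR * S => (ginv (N p.2) p.1, p.2) : TR * S).
Proof. by apply: measurable_fun_pair => //; exact: measurable_ginv. Qed.

Let mPhi : measurable_fun setT Phi := measurable_ginv_pair.

Variable Q : {sigma_finite_measure set S -> \bar R}.

(* On subsets of ]0, 1] x S this is the measure dN_s(w) Q(dw); at time 0 it
   collects the junk values of [ginv]. *)
Definition stieltjes_measure : {measure set (TR * S) -> \bar R} :=
  pushmeasure (lebesgue_measure \x Q)%E measurable_ginv_pair.

Variable f : TR * S -> \bar R.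
Hypothesis mf : measurable_fun ((`]0, 1]%classic : set TR) `*` [set: S]) f.
Hypothesis f0 : forall p, (0 <= f p)%E.
Variables (a b : R).
Hypotheses (a0 : 0 <= a) (ab : a <= b) (b1 : b <= 1).

Let ab01 : (`]a, b]%classic : set TR) `<=` `]0, 1]%classic.
Proof.
move=> x /=; rewrite !in_itv/= => /andP[ax xb].
by rewrite (le_lt_trans a0 ax) (le_trans xb).
Qed.

(** Cutting [f] off in time lets the inner integral run over all $y$: by [preimage_ginv] the cut-off
    selects exactly $]N_a, N_b]$, so the range no longer depends on $w$. *)
Let fab := f \_ ((`]a, b]%classic : set TR) `*` [set: S]).

Let mfab : measurable_fun setT fab.
Proof.
have mD : measurable ((`]a, b]%classic : set TR) `*` [set: S]).
  exact: measurableX.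
apply/(measurable_restrictT _ mD).
apply: (measurable_funS _ _ mf); first exact: measurableX.
by move=> -[s w] [/ab01].
Qed.

Let stieltjes_integralE w :
  (\int[lebesgue_stieltjes_measure (N w)]_(s in `]a, b]) f (s, w) =
   \int[lebesgue_measure]_y (fab \o Phi) (y, w))%E.
Proof.
rewrite stieltjes_integral_ginv//; last first.
  have : measurable_fun (`]a, b]%classic : set TR) (fun s => fab (s, w)).
    apply: measurable_funTS.
    by apply: (measurableT_comp mfab); exact: measurable_pair2.
  apply: eq_measurable_fun => s sab.
  by rewrite /fab patchE mem_set//; split=> //; exact: set_mem.
rewrite integral_mkcond; apply: eq_integral => y _.
rewrite -preimage_ginv// /fab /Phi /= /patch/=.
have -> : ((ginv (N w) y, w) \in `]a, b]%classic `*` setT) =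
  (y \in ginv (N w) @^-1` `]a, b]%classic).
  by apply/idP/idP => /set_mem H; apply/mem_set => //; case: H.
by [].
Qed.

Lemma measurable_stieltjes_integral : measurable_fun setT
  (fun w => \int[lebesgue_stieltjes_measure (N w)]_(s in `]a, b]) f (s, w))%E.
Proof.
under eq_fun do rewrite stieltjes_integralE.
apply: (measurable_fun_fubini_tonelli_G (m1 := lebesgue_measure) (fab \o Phi)).
- exact: measurableT_comp.
- by move=> p; rewrite /fab/= /patch; case: ifP.
Qed.

Lemma stieltjes_tonelli (A : set S) : measurable A ->
  (\int[stieltjes_measure]_(p in `]a, b]%classic `*` A) f p =
   \int[Q]_(w in A)
     \int[lebesgue_stieltjes_measure (N w)]_(s in `]a, b]) f (s, w))%E.
Proof.
move=> mA.
have mE : measurable ((`]a, b]%classic : set TR) `*` A) by exact: measurableX.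
have mfE : measurable_fun ((`]a, b]%classic : set TR) `*` A) f.
  apply: (measurable_funS _ _ mf); first exact: measurableX.
  by move=> -[s w] [/ab01].
have mPE : measurable (Phi @^-1` (`]a, b]%classic `*` A)).
  by rewrite -[X in measurable X]setTI; exact: mPhi.
transitivity (\int[(lebesgue_measure \x Q)]_(p in
  Phi @^-1` (`]a, b]%classic `*` A)) (f \o Phi) p)%E.
  have := @ge0_integral_pushforward _ _ _ _ R _ measurable_ginv_pair
    (lebesgue_measure \x Q)%E _ f mE mfE (fun p _ => f0 p).
  by move=> <-.
rewrite integral_mkcond fubini_tonelli2/=; last 2 first.
- apply/(measurable_restrictT _ mPE); apply: (measurable_comp mE).
  + exact: image_preimage_subset.
  + exact: mfE.
  + exact: measurable_funTS.
- by move=> p; rewrite /patch; case: ifP => // _; exact: f0.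
rewrite [RHS]integral_mkcond; apply: eq_integral => w _.
rewrite {2}/patch; case: ifPn => [/set_mem Aw|Aw].
  rewrite stieltjes_integralE /fubini_G; apply: eq_integral => y _.
  rewrite /fab /= /patch/=.
  by congr (if _ then _ else _); apply/idP/idP => /set_mem[/= H1 H2];
    apply/mem_set.
rewrite /fubini_G integral0_eq// => y _; rewrite /patch; case: ifPn => //.
by move=> /set_mem[/= _ /mem_set]; rewrite (negbTE Aw).
Qed.

End stieltjes_tonelli.

Lemma stieltjes_measure_rect {R : realType} d (S : measurableType d)
    (N : S -> cumulative R R) (N0 : forall w, N w 0 = 0)
    (mN : forall t, 0 <= t <= 1 -> measurable_fun setT (fun w => N w t))
    (Q : {sigma_finite_measure set S -> \bar R}) (a b : R) (A : set S) :
  0 <= a -> a <= b -> b <= 1 -> measurable A ->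
  (stieltjes_measure mN Q (`]a, b]%classic `*` A) =
   \int[Q]_(w in A) (N w b - N w a)%:E)%E.
Proof.
move=> a0 ab b1 mA.
rewrite -[LHS]mul1e -integral_cst; last exact: measurableX.
rewrite stieltjes_tonelli//.
apply: eq_integral => w _.
by rewrite integral_cst ?mul1e//; exact: stieltjes_ocitv.
Qed.

Section tonelli_rect.
Context d1 d2 (T1 : measurableType d1) (T2 : measurableType d2) (R : realType).
Variable m1 : {sigma_finite_measure set T1 -> \bar R}.
Variable m2 : {sigma_finite_measure set T2 -> \bar R}.

Lemma tonelli_rect (f : T1 * T2 -> \bar R) (A : set T1) (B : set T2) :
  measurable A -> measurable B ->
  measurable_fun (A `*` B) f -> (forall p, 0 <= f p)%E ->
  (\int[m1 \x m2]_(p in A `*` B) f p =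
   \int[m2]_(y in B) \int[m1]_(x in A) f (x, y))%E.
Proof.
move=> mA mB mf f0.
have mAB : measurable (A `*` B) by exact: measurableX.
rewrite integral_mkcond fubini_tonelli2/=; last 2 first.
- exact/(measurable_restrictT _ mAB).
- by move=> p; rewrite /patch; case: ifP.
rewrite [RHS]integral_mkcond; apply: eq_integral => y _.
rewrite {2}/patch; case: ifPn => [/set_mem By|By].
  rewrite /fubini_G [RHS]integral_mkcond; apply: eq_integral => x _.
  rewrite /patch/=.
  by congr (if _ then _ else _); apply/idP/idP => /set_mem H;
    apply/mem_set; [case: H|split].
rewrite /fubini_G integral0_eq// => x _; rewrite /patch; case: ifPn => //.
by move=> /set_mem[/= _ /mem_set]; rewrite (negbTE By).
Qed.

Lemma measurable_tonelli_rect (f : T1 * T2 -> \bar R) (A : set T1) :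
  measurable A ->
  measurable_fun (A `*` setT) f -> (forall p, 0 <= f p)%E ->
  measurable_fun setT (fun y => \int[m1]_(x in A) f (x, y))%E.
Proof.
move=> mA mf f0.
have mAB : measurable (A `*` [set: T2]) by exact: measurableX.
have -> : (fun y => \int[m1]_(x in A) f (x, y))%E =
    fubini_G m1 (f \_ (A `*` setT)).
  apply/funext => y; rewrite /fubini_G [LHS]integral_mkcond.
  apply: eq_integral => x _; rewrite /patch/=.
  by congr (if _ then _ else _); apply/idP/idP => /set_mem H;
    apply/mem_set; [split|case: H].
apply: measurable_fun_fubini_tonelli_G.
- exact/(measurable_restrictT _ mAB).
- by move=> p; rewrite /patch; case: ifP.
Qed.

End tonelli_rect.

Lemma cvg_eventually_cst (R : realType) (u : nat -> \bar R) (l : \bar R) (k0 : nat) :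
  (forall k, (k0 <= k)%N -> u k = l) -> u @ \oo --> l.
Proof. by move=> ul; apply: cvg_near_cst; exists k0. Qed.

(** * The compensated process on a predictable rectangle *)

Section compensated_increment.
Context {R : realType} d (S : measurableType d) (Q : probability S R).
Variables (H : R -> set (set S)) (N : S -> cumulative R R) (l : R -> S -> R).
Variable C : R.
Hypothesis C0 : 0 <= C.
Hypothesis Hsub : forall t, 0 <= t <= 1 -> H t `<=` measurable.
Hypothesis mN : forall t, 0 <= t <= 1 -> measurable_fun setT (fun w => N w t).
Hypothesis hl : is_intensity Q H N l.
Hypothesis lC : {ae Q, forall w, forall t : R, 0 <= t <= 1 -> l t w <= C}.

Let J (a b : R) w : \bar R :=
  (\int[lebesgue_measure]_(u in `]a, b]) (Num.max (C - l u w) 0)%:E)%E.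

Hypothesis mJ : forall a b, 0 <= a -> a <= b -> b <= 1 -> measurable_fun setT (J a b).

(** A stopping time is constrained only through its events up to time 1, so measurability is claimed
    for its minimum with [t] and not for [tau] itself. *)
Lemma measurable_min_stopping (tau : S -> R) t : stopping_time H tau ->
  0 <= t <= 1 -> measurable_fun setT (fun w => Num.min t (tau w)).
Proof.
move=> [tau0 Htau] t01.
apply: (measurability (@RGenOInfty.G R)) => [|/= _ [_] [r] -> <-].
  exact: RGenOInfty.measurableE.
rewrite setTI.
have [r0|r0] := ltP r 0.
  rewrite [X in measurable X](_ : _ = setT)//.
  apply/seteqP; split => // w _ /=; rewrite in_itv/= andbT.
  by rewrite (lt_le_trans r0)// le_min tau0; case/andP: t01 => ->.
have [tr|rt] := leP t r.
  rewrite [X in measurable X](_ : _ = set0)//.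
  apply/seteqP; split => // w /=; rewrite in_itv/= andbT ltNge => /negP; apply.
  by rewrite ge_min tr.
have r01 : 0 <= r <= 1 by rewrite r0 (le_trans (ltW rt))//; case/andP: t01.
rewrite [X in measurable X](_ : _ = ~` [set w | tau w <= r]).
  by apply: measurableC; apply: (Hsub r01); exact: Htau.
apply/seteqP; split => [w|w]/=; rewrite in_itv/= andbT lt_min rt/= ltNge.
  by move/negP.
by move=> /negP.
Qed.

(** For the process stopped at [tau k] this is the martingale property tested on [A]. The stopped
    integrands are increments of $N+\int(C-l)$, almost surely nondecreasing in time, so they grow
    with [k] and monotone convergence removes the stopping without any integrability of [N]. *)
Lemma compensated_increment (A : set S) (s t : R) :
  0 <= s -> s < t -> t <= 1 -> H s A ->
  (\int[Q]_(w in A) ((N w t - N w s)%:E + J s t w) = (C * (t - s))%:E * Q A)%E.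
Proof.
move=> s0 st t1 HA.
have t0 : 0 <= t by rewrite (le_trans s0)// ltW.
have s1 : s <= 1 by rewrite (le_trans (ltW st)).
have s01 : 0 <= s <= 1 by rewrite s0.
have t01 : 0 <= t <= 1 by rewrite t0.
have mA : measurable A := Hsub s01 HA.
case: hl => _ il [tau [stau atau Mtau]].
pose L r w := \int[lebesgue_measure]_(u in `[0, r]) l u w.
pose M r w := N w r - L r w.
(* [V k] is the increment of $N+\int(C-l)$ over ]s, t] stopped at [tau k], and [c k] is $C$ times
   the length of the stopped interval; they have the same integral over [A]. *)
pose V k w := M (Num.min t (tau k w)) w - M (Num.min s (tau k w)) w +
  C * (Num.min t (tau k w) - Num.min s (tau k w)).
pose c k w := C * (Num.min t (tau k w) - Num.min s (tau k w)).
have mmin k r : 0 <= r <= 1 -> measurable_fun setT (fun w => Num.min r (tau k w)).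
  exact: measurable_min_stopping.
have mc k : measurable_fun setT (c k).
  by apply: measurable_funM => //; apply: measurable_funB; exact: mmin.
have ic k : Q.-integrable A (EFin \o c k).
  apply: measurable_bounded_integrable => //.
  - by rewrite (le_lt_trans (probability_le1 Q mA))// ltry.
  - exact: measurable_funTS.
  - exists (C * 1); split; rewrite ?num_real// => x Cx w Aw /=.
    apply: le_trans (ltW Cx).
    rewrite /c normrM (ger0_norm C0) ler_wpM2l//.
    have := (stau k).1 w; rewrite ler_norml /Num.min.
    by case: ifP; case: ifP; lra.
have MtauI k r : 0 <= r <= 1 ->
    Q.-integrable setT (EFin \o (fun w => M (Num.min r (tau k w)) w)).
  by move=> r01; have [_ + _] := Mtau k; exact.
have iM k r : 0 <= r <= 1 ->
    Q.-integrable A (EFin \o (fun w => M (Num.min r (tau k w)) w)).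
  by move=> r01; apply: integrableS (MtauI k r r01).
have VE k : (\int[Q]_(w in A) (V k w)%:E = \int[Q]_(w in A) (c k w)%:E)%E.
  have -> : (\int[Q]_(w in A) (V k w)%:E = \int[Q]_(w in A)
    (((M (Num.min t (tau k w)) w)%:E -
     (M (Num.min s (tau k w)) w)%:E) + (c k w)%:E))%E.
    by apply: eq_integral => w _; rewrite /V/= -EFinB -EFinD.
  rewrite integralD//; last 2 first.
  - by have := integrableB mA (iM k t t01) (iM k s s01).
  - exact: ic.
  rewrite integralB_EFin//; [|exact: iM..].
  have [_ _ /(_ s t s0 (ltW st) t1)[_ _ _ /(_ A HA)]] := Mtau k.
  rewrite /= => ->; rewrite subee ?add0e//.
  by apply: integrable_fin_num => //; exact: iM.
have mV k : measurable_fun setT (V k).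
  apply: measurable_funD; last exact: mc.
  by apply: measurable_funB; apply/measurable_EFinP; apply: measurable_int;
    exact: MtauI.
have good : {ae Q, forall w, A w ->
   [/\ forall k, 0 <= V k w /\ 0 <= c k w,
      nondecreasing_seq (V ^~ w) /\ nondecreasing_seq (c ^~ w) &
      exists k0, forall k, (k0 <= k)%N ->
        ((V k w)%:E = (N w t - N w s)%:E + J s t w)%E /\ c k w = C * (t - s)]}.
  move: il lC atau; apply: filterS3 => w ilw lCw [taund [k0 tau1]] Aw.
  pose inc a b := N w b - N w a + (C * (b - a) - (L b w - L a w)).
  have incE a b : 0 <= a -> a <= b -> b <= 1 ->
      ((inc a b)%:E = (N w b - N w a)%:E + J a b w)%E.
    by move=> a0 ab b1; rewrite /J (path_compensator ilw lCw)// -EFinD.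
  have inc0 a b : 0 <= a -> a <= b -> b <= 1 -> 0 <= inc a b.
    move=> a0 ab b1; rewrite -lee_fin incE// adde_ge0//.
      by rewrite lee_fin subr_ge0; exact: cumulative_is_nondecreasing.
    by apply: integral_ge0 => u _; rewrite lee_fin le_max lexx orbT.
  have incD a b b' : inc a b' = inc a b + inc b b' by rewrite /inc; ring.
  have VincE k : V k w = inc (Num.min s (tau k w)) (Num.min t (tau k w)).
    by rewrite /V /inc /M; ring.
  have tau0 k : 0 <= tau k w := (stau k).1 w.
  have le_mins k : Num.min s (tau k w) <= Num.min t (tau k w).
    by rewrite /Num.min; case: ifP; case: ifP; lra.
  have min0 k r : 0 <= r -> 0 <= Num.min r (tau k w).
    by move=> r0; rewrite le_min r0 tau0.
  have min1 k r : r <= 1 -> Num.min r (tau k w) <= 1.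
    by move=> r1; rewrite ge_min r1.
  have taunnd : nondecreasing_seq (tau ^~ w) by exact/nondecreasing_seqP.
  split.
  - move=> k; split; first by rewrite VincE inc0// ?min0 ?min1.
    by rewrite mulr_ge0// subr_ge0.
  - have step k : c k w <= c k.+1 w /\ V k w <= V k.+1 w.
      have tk := taund k.
      split.
        by rewrite ler_wpM2l// /Num.min; do 4 case: ifP; lra.
      rewrite !VincE.
      (* If stopping occurs by time [s], both endpoints coincide and [V k] vanishes. Otherwise the
         left endpoint is [s] for [k] and for [k.+1], and additivity of [inc] applies. *)
      have [ts|st'] := leP (tau k w) s.
        rewrite (_ : Num.min t (tau k w) = tau k w); last first.
          by rewrite min_r// (le_trans ts)// ltW.
        rewrite {1}/inc !subrr mulr0 !subrr addr0.
        by apply: inc0; rewrite ?min0 ?min1.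
      rewrite (_ : Num.min s (tau k.+1 w) = s); last first.
        by rewrite min_l// (le_trans (ltW st')).
      rewrite (incD s (Num.min t (tau k w)) (Num.min t (tau k.+1 w))) lerDl inc0 ?min0 ?min1//.
      by rewrite /Num.min; case: ifP; case: ifP; lra.
    by split; apply/nondecreasing_seqP => k; have [] := step k.
  (* Since [tau] reaches 1 after finitely many steps, both sequences are eventually constant, which
     identifies their limits. *)
  - exists k0 => k k0k.
    have tk1 : 1 <= tau k w by rewrite (le_trans tau1)// taunnd.
    have mt : Num.min t (tau k w) = t by rewrite min_l// (le_trans t1).
    have ms : Num.min s (tau k w) = s by rewrite min_l// (le_trans s1).
    by rewrite /c VincE mt ms incE// ltW.
have mf : measurable_fun A (fun w => ((N w t - N w s)%:E + J s t w)%E).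
  apply: measurable_funTS; apply: emeasurable_funD; last exact/mJ/t1/ltW.
  by apply/measurable_EFinP; apply: measurable_funB; exact: mN.
have cV : (\int[Q]_(w in A) (V k w)%:E)%E @[k --> \oo] -->
    (\int[Q]_(w in A) ((N w t - N w s)%:E + J s t w))%E.
  apply: (@ae_monotone_convergence _ _ _ _ _ (fun k w => (V k w)%:E)) => //.
    by move=> k; apply/measurable_EFinP; exact: measurable_funTS.
  apply: filterS good => w /[apply]-[V0 [ndV _] [k0 k0E]]; split.
  - by move=> k; rewrite lee_fin; have [] := V0 k.
  - by move=> i j ij; rewrite lee_fin; exact: ndV.
  - by apply: (@cvg_eventually_cst _ _ _ k0) => k /k0E[].
have cc : (\int[Q]_(w in A) (c k w)%:E)%E @[k --> \oo] -->
    (\int[Q]_(w in A) (C * (t - s))%:E)%E.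
  apply: (@ae_monotone_convergence _ _ _ _ _ (fun k w => (c k w)%:E)) => //.
    by move=> k; apply/measurable_EFinP; exact: measurable_funTS.
  apply: filterS good => w /[apply]-[V0 [_ ndc] [k0 k0E]]; split.
  - by move=> k; rewrite lee_fin; have [] := V0 k.
  - by move=> i j ij; rewrite lee_fin; exact: ndc.
  - by apply: (@cvg_eventually_cst _ _ _ k0) => k /k0E[_ ->].
rewrite (_ : (fun k => _) = (fun k => \int[Q]_(w in A) (c k w)%:E)%E) in cV; last first.
  by apply/funext.
rewrite -(integral_cst Q mA (C * (t - s))%:E).
exact: (cvg_unique _ cV cc).
Qed.

End compensated_increment.

Lemma ge0_integral_mrestr d (T : measurableType d) (R : realType)
    (mu : {measure set T -> \bar R}) (D : set T) (mD : measurable D)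
    (f : T -> \bar R) :
  measurable_fun setT f -> (forall x, 0 <= f x)%E ->
  (\int[mrestr mu mD]_x f x = \int[mu]_(x in D) f x)%E.
Proof.
move=> mf f0.
have null : mrestr mu mD (~` D) = 0 by rewrite /mrestr setICl measure0.
rewrite (ge0_negligible_integral (measurableC mD) _ _ _ null)//=.
rewrite setTD setCK; apply: eq_measure_integral => A mA AD.
by rewrite /= /mrestr setIidl.
Qed.

Section density_measure.
Context d (T : measurableType d) (R : realType).
Variables (mu : {measure set T -> \bar R}) (f : T -> \bar R).
Hypotheses (mf : measurable_fun setT f) (f0 : forall x, (0 <= f x)%E).

Let nu (A : set T) : \bar R := (\int[mu]_(x in A) f x)%E.

Let nu0 : nu set0 = 0%E. Proof. exact: integral_set0. Qed.

Let nu_ge0 A : (0 <= nu A)%E. Proof. exact: integral_ge0. Qed.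

Let nu_sigma_additive : semi_sigma_additive nu.
Proof. exact: semi_sigma_additive_nng_induced. Qed.

Let nu_mixin := isMeasure.Build _ _ _ nu nu0 nu_ge0 nu_sigma_additive.

Definition density_measure : {measure set T -> \bar R} := HB.pack nu nu_mixin.

End density_measure.

(** * The predictable sigma-algebra as a measurable type *)

Definition time_strip (R : realType) (S : Type) : set (R * S) :=
  (`[0, 1]%classic : set R) `*` setT.

Section predictable.
Context {R : realType} d (S : measurableType d).
Local Notation TR := (measurableTypeR R).
Variable H : R -> set (set S).

Local Notation time_strip := (@time_strip R S).

Lemma measurable_time_strip : measurable (time_strip : set (TR * S)).
Proof. exact: measurableX. Qed.

Lemma predictable_sigma_strip E : predictable_sigma H E -> E `<=` time_strip.
Proof.
move: E; apply: (@smallest_sub _ _ _ [set E | E `<=` time_strip]).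
  split=> /=; first exact: sub0set.
    by move=> A _; exact: subDsetl.
  by move=> F FD; apply: bigcup_sub => i _; exact: FD.
move=> E [[A _ ->]|[s [t [A [s0 st t1 _ ->]]]]] [u w]/= [].
  by move=> -> _; split => //=; rewrite in_itv/= lexx ler01.
rewrite in_itv/= => /andP[su ut] _; split => //=; rewrite in_itv/=.
by rewrite (le_trans s0 (ltW su)) (le_trans ut t1).
Qed.

Hypothesis Hsub : forall t, 0 <= t <= 1 -> H t `<=` measurable.

Lemma predictable_sigma_measurable : predictable_sigma H `<=` (measurable : set (set (TR * S))).
Proof.
apply: smallest_sub.
  split; first exact: measurable0.
    by move=> A mA; apply: measurableD => //; exact: measurable_time_strip.
  by move=> F mF; exact: bigcupT_measurable.
move=> E [[A HA ->]|[s [t [A [s0 st t1 HA ->]]]]].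
  by apply: measurableX => //; apply: (@Hsub 0) => //; rewrite lexx ler01.
apply: measurableX => //; apply: (@Hsub s) => //.
by rewrite s0 (le_trans (ltW st)).
Qed.

Local Notation PT := (g_sigma_algebraType (predictable_sigma H)).

Lemma measurable_id_predictable : measurable_fun setT (id : TR * S -> PT).
Proof.
move=> _ E mE; rewrite setTI preimage_id.
move: E mE; apply: (@smallest_sub _ _ _ (measurable : set (set (TR * S)))).
  exact: sigma_algebra_measurable.
exact: predictable_sigma_measurable.
Qed.

(** In [PT] complements are taken in the whole of R x S, in [predictable_sigma] relative to the
    strip; intersecting with the strip translates the first into the second. *)
Lemma predictable_sigma_setI E : (measurable : set (set PT)) E ->
  predictable_sigma H (time_strip `&` E).
Proof.
have [P0 PC PU] := smallest_sigma_algebra time_strip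
  ([set E | exists2 A, H 0 A & E = [set 0] `*` A]
      `|` [set E | exists s t A,
             [/\ 0 <= s, s < t, t <= 1, H s A & E = `]s, t] `*` A]]).
move: E; apply: (@smallest_sub _ _ _
    [set E | predictable_sigma H (time_strip `&` E)]).
  split.
  - by rewrite /= setI0.
  - move=> A /= PA; rewrite (_ : _ `&` _ = time_strip `\` (time_strip `&` A)).
      exact: PC.
    by rewrite setTD setDE setCI setIUr setICr set0U.
  - by move=> F PF; rewrite /= setI_bigcupr; exact: PU.
by move=> E PE /=; rewrite setIidr//; exact: predictable_sigma_strip.
Qed.

End predictable.

Lemma time_strip_set (R : realType) (S : Type) :
  @time_strip R S = [set 0] `*` setT `|` (`]0, 1]%classic : set R) `*` setT.
Proof.
apply/seteqP; split => -[u w]; rewrite /= /time_strip/= ?in_itv/=.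
  move=> [/andP[u0 u1] _]; have [u_gt0|u_le0] := ltP 0 u.
    by right; split=> //; rewrite u_gt0.
  by left; split=> //; apply/eqP; rewrite eq_le u_le0.
by case=> -[] => [->|/andP[u0 u1]] _; split=> //;
  rewrite ?lexx ?ler01// ltW.
Qed.

Section predictable_measurable.
Context {R : realType} d (S : measurableType d) (H : R -> set (set S)).
Hypothesis Hsub : forall t, 0 <= t <= 1 -> H t `<=` measurable.
Local Notation TR := (measurableTypeR R).
Local Notation PT := (g_sigma_algebraType (predictable_sigma H)).
Local Notation strip := (@time_strip R S).

Lemma predictable_measurable (Y : R -> S -> R) : predictable H Y ->
  measurable_fun (strip : set (TR * S)) (fun p => Y p.1 p.2).
Proof.
by move=> pY _ B mB; apply: (predictable_sigma_measurable Hsub); exact: pY.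
Qed.

Lemma predictable_strip : predictable_sigma H strip.
Proof.
have [P0 PC _] := smallest_sigma_algebra strip
  ([set E | exists2 A, H 0 A & E = [set 0] `*` A]
      `|` [set E | exists s t A,
             [/\ 0 <= s, s < t, t <= 1, H s A & E = `]s, t] `*` A]]).
by rewrite -[X in predictable_sigma _ X]setD0; exact: PC.
Qed.

Lemma predictable_measurable_strip : (measurable : set (set PT)) strip.
Proof. by apply: sub_sigma_algebra; exact: predictable_strip. Qed.

Lemma predictableP (Y : R -> S -> R) : predictable H Y <->
  measurable_fun (strip : set PT) (fun p : PT => Y p.1 p.2).
Proof.
split=> [pY _ B mB|mY B mB].
  by apply: sub_sigma_algebra; exact: pY.
have := mY predictable_measurable_strip B mB.
by move=> /predictable_sigma_setI; rewrite setIA setIid.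
Qed.

End predictable_measurable.

(** * Stieltjes integrals of predictable processes *)

Section predictable_intensity.
Context {R : realType} d (S : measurableType d) (Q : probability S R).
Variables (H : R -> set (set S)) (N : S -> cumulative R R) (l : R -> S -> R).
Variable C : R.
Hypothesis C0 : 0 <= C.
Hypothesis Hsig : forall t, 0 <= t <= 1 -> sigma_algebra setT (H t).
Hypothesis Hsub : forall t, 0 <= t <= 1 -> H t `<=` measurable.
Hypothesis Hmono : forall s t, 0 <= s -> s <= t -> t <= 1 -> H s `<=` H t.
Hypothesis N0 : forall w, N w 0 = 0.
Hypothesis mN : forall t, 0 <= t <= 1 -> measurable_fun setT (fun w => N w t).
Hypothesis hl : is_intensity Q H N l.
Hypothesis lC : {ae Q, forall w, forall t : R, 0 <= t <= 1 -> l t w <= C}.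

Local Notation TR := (measurableTypeR R).
Local Notation PT := (g_sigma_algebraType (predictable_sigma H)).
Local Notation strip := (@time_strip R S : set (TR * S)).
Local Notation leb := (@lebesgue_measure R).

Let gap (p : TR * S) : \bar R := (Num.max (C - l p.1 p.2) 0)%:E.

Let gap0 p : (0 <= gap p)%E. Proof. by rewrite lee_fin le_max lexx orbT. Qed.

Let mgap : measurable_fun (strip : set (TR * S)) gap.
Proof.
apply/measurable_EFinP; apply: measurable_maxr => //.
apply: measurable_funB => //; apply: (predictable_measurable Hsub).
by case: hl.
Qed.

(** The density is extended by zero off the strip, because [density_measure] asks for measurability
    on the whole space. *)
Let gapS : TR * S -> \bar R := gap \_ strip.

Let mgapS : measurable_fun setT gapS.
Proof. exact/(measurable_restrictT _ (@measurable_time_strip R _ S)). Qed.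

Let gapS0 p : (0 <= gapS p)%E.
Proof. by rewrite /gapS /patch; case: ifP. Qed.

Let mJ a b : 0 <= a -> a <= b -> b <= 1 -> measurable_fun setT
  (fun w => \int[leb]_(u in `]a, b]) (Num.max (C - l u w) 0)%:E)%E.
Proof.
move=> a0 ab b1.
apply: (@measurable_tonelli_rect _ _ TR S _ leb gap `]a, b]%classic) => //.
apply: (measurable_funS (@measurable_time_strip R _ S) _ mgap).
move=> -[u w] [/=]; rewrite !in_itv/= => /andP[au ub] _; split => //=.
by rewrite in_itv/= (le_trans a0 (ltW au)) (le_trans ub).
Qed.

Let moc : measurable ((`]0, 1]%classic : set TR) `*` [set: S]).
Proof. exact: measurableX. Qed.

(** With respect to $Q(dw)$, [m1] is $dN$ on ]0, 1], [m2] is the slack $(C-l)^+dt$, and [m3] is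
    $C\,dt$ on [0, 1]. The aim is [m1 + m2 = m3] on predictable sets. *)
Let m1 : {measure set (TR * S) -> \bar R} := mrestr (stieltjes_measure mN Q) moc.
Let m2 : {measure set (TR * S) -> \bar R} :=
  density_measure (leb \x Q)%E mgapS gapS0.
Let m12 : {measure set (TR * S) -> \bar R} := measure_add m1 m2.
Let m3 : {measure set (TR * S) -> \bar R} :=
  mscale (NngNum C0) (mrestr (leb \x Q)%E (@measurable_time_strip R _ S)).

Let m12E E : m12 E = (stieltjes_measure mN Q (E `&` (`]0%R, 1%R]%classic : set TR) `*` setT) +
  \int[leb \x Q]_(p in E) gapS p)%E.
Proof. exact: (measure_addE m1 m2). Qed.

Let m3E E : m3 E = (C%:E * (leb \x Q) (E `&` strip))%E.
Proof. by []. Qed.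

(** This is [compensated_increment], read as an equality between two measures of a rectangle. *)
Let m123_rect s t A : 0 <= s -> s < t -> t <= 1 -> H s A ->
  m12 (`]s, t]%classic `*` A) = m3 (`]s, t]%classic `*` A).
Proof.
move=> s0 st t1 HA.
have mA : measurable A.
  by apply: (Hsub _ HA); rewrite s0 (le_trans (ltW st)).
have stoc : (`]s, t]%classic : set TR) `*` A `<=` `]0, 1]%classic `*` setT.
  move=> -[u w] [/=]; rewrite !in_itv/= => /andP[su ut] _; split => //=.
  by rewrite ?in_itv/= (le_lt_trans s0 su) (le_trans ut).
have ststrip : (`]s, t]%classic : set TR) `*` A `<=` strip.
  by move=> p /stoc; rewrite time_strip_set; right.
have mst : measurable ((`]s, t]%classic : set TR) `*` A) by exact: measurableX.
rewrite m12E m3E !setIidl//.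
rewrite stieltjes_measure_rect//; last exact: ltW.
rewrite product_measure1E//.
rewrite [X in (_ * (X * _))%E]lebesgue_measure_itv/= lte_fin st -EFinB muleA -EFinM.
rewrite -(compensated_increment C0 Hsub mN hl lC)//.
rewrite ge0_integralD//; last 4 first.
- by move=> w _; rewrite lee_fin subr_ge0 cumulative_is_nondecreasing// ltW.
- apply: measurable_funTS; apply/measurable_EFinP; apply: measurable_funB.
    by apply: mN; rewrite (le_trans s0 (ltW st)).
  by apply: mN; rewrite s0 (le_trans (ltW st)).
- by move=> w _; apply: integral_ge0 => u _; exact: (gap0 (u, w)).
- by apply: measurable_funTS; apply: mJ => //; exact: ltW.
congr (_ + _)%E; rewrite -(tonelli_rect leb Q (f := gap))//; last first.
  exact: (measurable_funS (@measurable_time_strip R _ S) _ mgap).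
by apply: eq_integral => p /set_mem/ststrip pD; rewrite /gapS patchE mem_set.
Qed.

(** The generators of the predictable sigma-algebra include sets at time 0, where neither $dN$
    restricted to ]0, 1] nor $dt$ has mass. *)
Let m12_zero A : measurable A -> m12 ([set 0] `*` A) = 0%E.
Proof.
move=> mA.
have m0A : measurable ([set 0 : TR] `*` A) by exact: measurableX.
have Z : (leb \x Q)%E (([set 0] : set TR) `*` A) = 0%E.
  by rewrite product_measure1E// [X in (X * _)%E]lebesgue_measure_set1 mul0e.
have mg0 : measurable_fun (([set 0] : set TR) `*` A) gapS by exact: measurable_funTS.
rewrite m12E (null_set_integral m0A mg0 Z) adde0 (_ : _ `&` _ = set0) ?measure0//.
by apply/seteqP; split=> // -[u w] [[/= -> _] []]; rewrite /= in_itv/= ltxx.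
Qed.

Let m3_zero A : measurable A -> m3 ([set 0] `*` A) = 0%E.
Proof.
move=> mA.
rewrite m3E setIidl; last first.
  by rewrite time_strip_set => -[u w] [/= -> _]; left.
by rewrite product_measure1E// [X in (_ * (X * _))%E]lebesgue_measure_set1 mul0e mule0.
Qed.

(** Finite measures that agree on a pi-system agree on the sigma-algebra it generates. The strip is
    not itself a generator, so its mass is compared through its decomposition into time 0 and ]0,
    1]. *)
Let m123 E : predictable_sigma H E -> m12 E = m3 E.
Proof.
pose G := [set E | exists2 A, H 0 A & E = [set 0] `*` A]
      `|` [set E | exists s t A,
             [/\ 0 <= s, s < t, t <= 1, H s A & E = `]s, t] `*` A]].
have GD X : G X -> X `<=` strip.
  by move=> GX; apply: predictable_sigma_strip; apply: sub_sigma_algebra GX.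
have HG : [set X | G X /\ X `<=` strip] = G.
  by apply/seteqP; split => [X []//|X GX]; split => //; exact: GD.
have HT t : 0 <= t <= 1 -> H t setT.
  by move=> t01; have [H0 HC _] := Hsig t01; rewrite -(setD0 setT); exact: HC.
have HI t : 0 <= t <= 1 -> setI_closed (H t).
  move=> t01 A B; have [_ _ _] := (sigma_algebraP (fun X _ => @subsetT _ X)).1 (Hsig t01).
  exact.
have i0 : 0 <= (0 : R) <= 1 by rewrite lexx ler01.
have G0 : G set0.
  by left; exists set0; [case: (Hsig i0)|rewrite setX0].
have mstrip := @measurable_time_strip R _ S.
have m12strip : m12 strip = m3 strip.
  have strip_split (m : {measure set (TR * S) -> \bar R}) :
      (m strip = m (([set 0%R] : set TR) `*` setT) +
        m ((`]0%R, 1%R]%classic : set TR) `*` setT))%E.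
    rewrite time_strip_set measureU//; first exact: measurableX.
    by apply/seteqP; split=> // -[u w] [[/= -> _] []]; rewrite /= in_itv/= ltxx.
  rewrite (strip_split m12) (strip_split m3) m12_zero// m3_zero//.
  by rewrite m123_rect//; exact: HT.
have m3strip : (m3 strip < +oo)%E.
  rewrite m3E setIid product_measure1E//.
  rewrite [X in (_ * (X * _))%E]lebesgue_measure_itv/= lte_fin ltr01 -EFinB subr0.
  by rewrite [X in (_ * (_ * X))%E](@probability_setT _ _ _ Q) !mule1 ltry.
move=> PE.
have U := @g_sigma_algebra_measure_unique_trace _ R (TR * S)%type G strip mstrip.
rewrite HG in U.
apply: (U _ _ m12 m3 m12strip _ _ _ E PE).
- by move=> X GX; apply: (predictable_sigma_measurable Hsub);
    apply: sub_sigma_algebra GX.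
- move=> X Y [[A HA ->]|[s [t [A [s0 st t1 HA ->]]]]]
             [[B HB ->]|[s' [t' [B [s'0 st' t'1 HB ->]]]]].
  + left; exists (A `&` B); first exact: HI.
    by rewrite -setXI setIid.
  + rewrite -setXI (_ : [set 0] `&` _ = set0) ?set0X; first exact: G0.
    by apply/seteqP; split=> // u [/= ->]; rewrite in_itv/= ltNge s'0.
  + rewrite -setXI (_ : _ `&` [set 0] = set0) ?set0X; first exact: G0.
    by apply/seteqP; split=> // u [/= + u0]; rewrite u0 in_itv/= ltNge s0.
  + rewrite -setXI (_ : _ `&` _ = `]Num.max s s', Num.min t t']%classic); last first.
      apply/seteqP; split => u /=; rewrite !in_itv/= gt_max le_min.
        by case=> /andP[-> ->] /andP[-> ->].
      by move=> /andP[/andP[-> ->] /andP[-> ->]].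
    have [mm|mm] := ltP (Num.max s s') (Num.min t t'); last first.
      by rewrite set_itv_ge ?set0X ?bnd_simp -?leNgt//; exact: G0.
    have m0 : 0 <= Num.max s s' by rewrite le_max s0.
    have m1' : Num.max s s' <= 1 by rewrite (le_trans (ltW mm))// ge_min t1.
    right; exists (Num.max s s'), (Num.min t t'), (A `&` B); split => //.
      by rewrite ge_min t1.
    (* Monotonicity of the filtration carries both events to the later of the two starting times,
       where they can be intersected. *)
    apply: HI; first by rewrite m0.
      by apply: (Hmono s0 _ m1') => //; rewrite le_max lexx.
    by apply: (Hmono s'0 _ m1') => //; rewrite le_max lexx orbT.
- move=> X [[A HA ->]|[s [t [A [s0 st t1 HA ->]]]]].
    by rewrite m12_zero ?m3_zero//; exact: (Hsub i0 HA).
  exact: m123_rect.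
- by rewrite m12strip.
- by move=> X; exact: predictable_sigma_strip.
Qed.

(** The measure [m12] dominates the one given by $dN$ and coincides with [m3] on predictable sets,
    hence for integrals of predictable functions. *)
Lemma le_stieltjes_predictable (f : R * S -> \bar R) :
  (forall p, 0 <= f p)%E ->
  measurable_fun (time_strip (S := S) : set PT) (f : PT -> \bar R) ->
  (\int[Q]_w \int[lebesgue_stieltjes_measure (N w)]_(s in `]0%R, 1%R]) f (s, w) <=
   C%:E * \int[Q]_w \int[leb]_(s in `[0%R, 1%R]) f (s, w))%E.
Proof.
move=> f0 mf.
have mid := measurable_id_predictable Hsub.
have mstripPT : (measurable : set (set PT)) (time_strip (S := S)).
  exact: predictable_measurable_strip.
have mstrip := @measurable_time_strip R _ S.
pose f' : PT -> \bar R := (f : PT -> \bar R) \_ (time_strip (S := S) : set PT).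
have mf' : measurable_fun setT f' by exact/(measurable_restrictT _ mstripPT).
have f'0 p : (0 <= f' p)%E by rewrite /f' /patch; case: ifP.
pose f'T : TR * S -> \bar R := f'.
have mf'T : measurable_fun setT f'T := measurableT_comp mf' mid.
have mfT : measurable_fun strip (f : TR * S -> \bar R).
  exact/(measurable_restrictT _ mstrip).
(* The identity pushes both measures to the predictable sigma-algebra, where alone they can be
   compared. Cutting a set with the strip changes neither mass. *)
have le_m S' : (measurable : set (set PT)) S' ->
    (pushmeasure m12 mid S' <= pushmeasure m3 mid S')%E.
  move=> mS'; rewrite -[leLHS]/(m12 S') -[leRHS]/(m3 S').
  have := m123 (predictable_sigma_setI mS').
  rewrite (_ : time_strip (S := S) `&` S' = S' `&` strip); last exact: setIC.
  have A1 : S' `&` strip `&` strip = S' `&` strip.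
    by rewrite setIidl//; exact: subIsetr.
  pose oc := (`]0%R, 1%R]%classic : set TR) `*` [set: S].
  have A2 : S' `&` strip `&` oc = S' `&` oc.
    apply/seteqP; split=> [p [[? _] ?]|p [? ?]]; split=> //; split=> //.
    by rewrite time_strip_set; right.
  by rewrite !m12E !m3E A1 A2 /gapS -!integral_mkcondr A1 => <-.
have stripE (u : R) w : 0 <= u <= 1 -> f'T (u, w) = f (u, w).
  by move=> u01; rewrite /f'T /f' patchE mem_set//; split.
have -> : (\int[Q]_w \int[lebesgue_stieltjes_measure (N w)]_(s in `]0%R, 1%R]) f (s, w) =
    \int[m1]_p f'T p)%E.
  rewrite ge0_integral_mrestr// -[RHS]/(\int[stieltjes_measure mN Q]_(p in
    (`]0%R, 1%R]%classic : set TR) `*` setT) f'T p)%E.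
  rewrite stieltjes_tonelli//; last exact: measurable_funTS.
  apply: eq_integral => w _; apply: eq_integral => u /set_mem/=.
  by rewrite in_itv/= => /andP[u0 u1]; rewrite stripE// u1 ltW.
have -> : (\int[Q]_w \int[leb]_(s in `[0%R, 1%R]) f (s, w) =
    \int[mrestr (leb \x Q)%E mstrip]_p f'T p)%E.
  rewrite ge0_integral_mrestr// tonelli_rect//; last exact: measurable_funTS.
  apply: eq_integral => w _; apply: eq_integral => u /set_mem/=.
  by rewrite in_itv/= => u01; rewrite stripE.
(* The slack [m2] is discarded here; this is the only place where equality becomes inequality. *)
apply: (@le_trans _ _ (\int[m12]_p f'T p)%E).
  by rewrite ge0_integral_measure_add// leeDl// integral_ge0.
apply: (@le_trans _ _ (\int[m3]_p f'T p)%E); last first.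
  by rewrite ge0_integral_mscale.
have push (m : {measure set (TR * S) -> \bar R}) :
    (\int[m]_p f'T p = \int[pushmeasure m mid]_p f' p)%E.
  exact/esym/(@ge0_integral_pushforward _ _ _ _ R _ mid m setT f' measurableT mf'
    (fun p _ => f'0 p)).
rewrite !push.
exact: (ge0_le_measure_integral le_m).
Qed.

End predictable_intensity.

(** * Left-continuous adapted processes *)

Section enlarge.
Context {R : realType} d (S : measurableType d) (Q : probability S R).
Variables (F : R -> set (set S)) (X : R -> S -> R).
Hypothesis hF : usual_filtration Q F.
Hypothesis mX : forall t : R, 0 <= t <= 1 -> measurable_fun setT (X t).

Let gen (s : R) : set (set S) :=
  <<s F s `|` \bigcup_(u in [set u | 0 <= u <= s])
                preimage_set_system setT (X u) measurable
          `|` [set A | Q.-negligible A] >>.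

(** The negligible sets among the generators are measurable because completeness puts them into
    [F 0]. *)
Let gen_sub t : 0 <= t <= 1 -> gen t `<=` measurable.
Proof.
move=> t01; apply: smallest_sub; first exact: sigma_algebra_measurable.
move=> A [[FA|[u /= /andP[u0 ut] [B mB <-]]]|nA].
- exact: (filtration_sub hF t01).
- by apply: mX => //; rewrite u0 (le_trans ut)//; case/andP: t01.
- apply: (filtration_sub hF _ (filtration_complete hF nA)).
  by rewrite lexx ler01.
Qed.

Lemma enlarge_sigma t : 0 <= t <= 1 -> sigma_algebra setT (enlarge Q F X t).
Proof.
move=> t01; rewrite /enlarge /right_lim; case: ifPn => _.
  by apply: sigma_algebra_bigcap => s _; exact: smallest_sigma_algebra.
exact: smallest_sigma_algebra.
Qed.

Lemma enlarge_measurable t : 0 <= t <= 1 -> enlarge Q F X t `<=` measurable.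
Proof.
move=> t01 A.
have g1 : gen 1 `<=` measurable by apply: gen_sub; rewrite ler01 lexx.
rewrite /enlarge /right_lim; case: ifPn => [t1 H|_ H]; apply: g1; last exact: H.
by apply: (H 1); rewrite /= t1 lexx.
Qed.

Lemma enlarge_mono s t : 0 <= s -> s <= t -> t <= 1 ->
  enlarge Q F X s `<=` enlarge Q F X t.
Proof.
move=> s0 st t1 A; rewrite /enlarge /right_lim.
case: ifPn => [s1 HA|s1 HA]; case: ifPn => [t1'|t1'].
- move=> u /= /andP[tu u1]; apply: HA; rewrite /= u1 andbT.
  exact: le_lt_trans tu.
- by apply: HA; rewrite /= s1 lexx.
- by move: s1; rewrite (le_lt_trans st).
- exact: HA.
Qed.

Lemma sub_enlarge t : 0 <= t <= 1 -> F t `<=` enlarge Q F X t.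
Proof.
move=> /andP[t0 t1] A FA; rewrite /enlarge /right_lim.
case: ifPn => [t1'|]; last first.
  rewrite -leNgt => t1'; apply: sub_sigma_algebra; left; left.
  by rewrite (_ : 1 = t)//; apply/eqP; rewrite eq_le t1 t1'.
move=> u /= /andP[tu u1]; apply: sub_sigma_algebra; left; left.
by apply: (filtration_mono hF) FA => //; exact: ltW.
Qed.

End enlarge.

Section grid.
Context {R : realType}.

(** For positive [t] this is the largest multiple of 1/(n+1) strictly below [t]. Strictness matters:
    values along the grid converge to the left limit even when the path jumps at [t]. *)
Definition grid (n : nat) (t : R) : R :=
  Num.max 0 ((Num.ceil (n.+1%:R * t) - 1)%:~R / n.+1%:R).

Lemma grid0 n : grid n 0 = 0.
Proof.
by rewrite /grid mulr0 ceil0 sub0r max_l// ler_pdivrMr// mul0r lerN10.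
Qed.

Lemma grid_ge0 n t : 0 <= grid n t.
Proof. by rewrite le_max lexx. Qed.

Lemma grid_lt n t : 0 < t -> grid n t < t.
Proof.
move=> t0; rewrite /grid gt_max t0/= ltr_pdivrMr// [t * _]mulrC.
by have /andP[] := ceil_itv (n.+1%:R * t).
Qed.

Lemma grid_ge n t : t - n.+1%:R^-1 <= grid n t.
Proof.
rewrite /grid le_max; apply/orP; right.
have /andP[_ tc] := ceil_itv (n.+1%:R * t).
by rewrite intrD mulrDl mulN1r lerD2r ler_pdivlMr// mulrC.
Qed.

Lemma grid_le1 n t : 0 <= t <= 1 -> 0 <= grid n t <= 1.
Proof.
move=> /andP[t0 t1]; rewrite grid_ge0/=; move: t0; rewrite le_eqVlt.
by move=> /predU1P[<-|/(grid_lt n)/ltW/le_trans->//]; rewrite grid0.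
Qed.

Lemma gridE n (k : nat) t : k%:R / n.+1%:R < t <= k.+1%:R / n.+1%:R ->
  grid n t = k%:R / n.+1%:R.
Proof.
rewrite ltr_pdivrMr// ler_pdivlMr// mulrC => /andP[kt tk].
have kE : k.+1%:Z - 1 = k%:Z by rewrite intS addrC addKr.
rewrite /grid (@ceil_def _ _ k.+1%:Z); first by rewrite kE max_r// divr_ge0.
by rewrite kE kt.
Qed.

Lemma grid_cvg t : 0 < t -> grid n t @[n --> \oo] --> t.
Proof.
move=> t0.
apply: (@squeeze_cvgr _ _ _ _ (fun n => t - n.+1%:R^-1) (fun=> t)).
- by apply: nearW => n; rewrite grid_ge/= ltW// grid_lt.
- rewrite -[X in _ --> X]subr0; apply: cvgB; first exact: cvg_cst.
  exact: cvg_harmonic.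
- exact: cvg_cst.
Qed.

Lemma cvg_grid (f : R -> R) (t l : R) : 0 < t ->
  f x @[x --> t^'-] --> l -> f (grid n t) @[n --> \oo] --> l.
Proof.
move=> t0 /cvg_at_leftP; apply; split; last exact: grid_cvg.
by move=> n; exact: grid_lt.
Qed.

End grid.

Section left_continuous_predictable.
Context {R : realType} d (S : measurableType d) (H : R -> set (set S)).

(** On each cell ]j/K, (j+1)/K] the process is frozen at its value at the left endpoint, known at
    time j/K. The event is thus a finite union of predictable rectangles, padded with empty sets to
    a sequence. *)
Lemma predictable_grid (Y : R -> S -> R) n : adapted H Y ->
  predictable H (fun t w => Y (grid n t) w).
Proof.
move=> aY B mB.
set K : R := n.+1%:R.
have K0 : 0 < K by rewrite /K.
have [P0 PC PU] := smallest_sigma_algebra (time_strip (S := S))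
  ([set E | exists2 A, H 0 A & E = [set 0 : R] `*` A]
      `|` [set E | exists s t A,
             [/\ 0 <= s, s < t, t <= 1, H s A & E = `]s, t] `*` A]]).
pose E k : set (R * S) := match k with
  | 0%N => [set 0] `*` (Y 0 @^-1` B)
  | j.+1 => if (j < n.+1)%N then
      `]j%:R / K, j.+1%:R / K]%classic `*` (Y (j%:R / K) @^-1` B) else set0
  end.
have -> : (`[0, 1] `*` setT) `&` [set p : R * S | B (Y (grid n p.1) p.2)] =
    \bigcup_k E k.
  apply/seteqP; split=> [[t w]|[t w] [[|j] _]].
  - move=> [[/= t01 _] BY]; move: (t01); rewrite in_itv/= => /andP[t0 t1].
    move: t0; rewrite le_eqVlt => /predU1P[t0|t0].
      by exists 0%N => //; split; rewrite /= -?t0 // -(grid0 n) t0.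
    have /andP[ct tc] := ceil_itv (K * t).
    have [j cE] : exists j, Num.ceil (K * t) = j.+1%:Z.
      have : (0 < Num.ceil (K * t)) by rewrite -(ltr_int R) (lt_le_trans _ tc)// mulr_gt0.
      by case: (Num.ceil (K * t)) => // -[//|j] _; exists j.
    have jE : j.+1%:Z - 1 = j%:Z by rewrite intS addrC addKr.
    rewrite cE jE in ct; rewrite cE in tc.
    have jt : j%:R / K < t <= j.+1%:R / K.
      by rewrite ltr_pdivrMr// ler_pdivlMr// mulrC ct.
    have jn : (j < n.+1)%N.
      by rewrite -(ltr_nat R) (lt_le_trans ct)// ler_piMr// ltW.
    exists j.+1 => //; rewrite /E jn; split; first by rewrite /= in_itv.
    by rewrite /= -(gridE jt).
  - by move=> [/= -> BY]; rewrite in_itv/= lexx ler01 grid0.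
  - rewrite /E; case: ifPn => // jn [/=]; rewrite in_itv/= => jt BY.
    split; last by rewrite /= (gridE jt).
    split=> //=; rewrite in_itv/=; case/andP: jt => jt tj.
    rewrite (le_trans _ (ltW jt)) ?divr_ge0 ?(ltW K0)//=.
    by rewrite (le_trans tj)// ler_pdivrMr// mul1r ler_nat.
apply: PU => -[|j] /=.
  apply: sub_sigma_algebra; left; exists (Y 0 @^-1` B) => //.
  by apply: aY => //; rewrite lexx ler01.
case: ifPn => jn; last exact: P0.
have jK : 0 <= j%:R / K by rewrite divr_ge0// ltW.
have jK1 : j.+1%:R / K <= 1 by rewrite ler_pdivrMr// mul1r ler_nat.
have jj : j%:R / K < j.+1%:R / K by rewrite ltr_pM2r ?invr_gt0// ltr_nat.
apply: sub_sigma_algebra; right; exists (j%:R / K), (j.+1%:R / K).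
exists (Y (j%:R / K) @^-1` B); split => //; apply: aY => //.
by rewrite jK (le_trans (ltW jj)).
Qed.

Lemma predictable_left_continuous (Y : R -> S -> R) : adapted H Y ->
  (forall w t, 0 < t <= 1 -> Y x w @[x --> t^'-] --> Y t w) ->
  predictable H Y.
Proof.
move=> aY lY; apply/predictableP.
apply: (@measurable_fun_cvg _ _ _ _
  (fun n (p : g_sigma_algebraType (predictable_sigma H)) => Y (grid n p.1) p.2)).
  by move=> n; exact: (predictableP H (fun t w => Y (grid n t) w)).1 (predictable_grid n aY).
move=> [t w] [/=]; rewrite in_itv/= => /andP[t0 t1] _.
move: t0; rewrite le_eqVlt => /predU1P[<-|t0].
  by under eq_fun do rewrite grid0; exact: cvg_cst.
by apply: (@cvg_grid _ (Y ^~ w)) => //; apply: lY; rewrite t0.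
Qed.

End left_continuous_predictable.

Lemma le_limn_einf_cst (R : realType) (u : nat -> \bar R) (M : \bar R) :
  (forall n, u n <= M)%E -> (limn_einf u <= M)%E.
Proof.
move=> uM; rewrite limn_einf_lim; apply: lime_le; first exact: is_cvg_einfs.
apply: nearW => n; apply: le_trans (uM n).
by apply: ereal_inf_lbound; exists n => //=.
Qed.

Lemma measurable_limn_einf d (T : measurableType d) (R : realType) (D : set T)
    (f : (T -> \bar R)^nat) : (forall n, measurable_fun D (f n)) ->
  measurable_fun D (fun x => limn_einf (f ^~ x)).
Proof.
move=> mf; under eq_fun do rewrite limn_einf_lim.
apply: (@emeasurable_fun_cvg _ _ _ _ (fun n x => einfs (f ^~ x) n)).
  by move=> n; exact: measurable_fun_einfs.
by move=> x _; exact: is_cvg_einfs.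
Qed.

Lemma measurable_rect_section d1 d2 d3 (T1 : measurableType d1)
    (T2 : measurableType d2) (T3 : measurableType d3) (A : set T1)
    (f : T1 * T2 -> T3) (y : T2) : measurable A ->
  measurable_fun (A `*` setT) f -> measurable_fun A (fun x => f (x, y)).
Proof.
move=> mA mf; apply: (measurable_comp _ _ mf (g := fun x => (x, y))).
- exact: measurableX.
- by move=> _ [x Ax <-].
- by apply: measurable_funTS; exact: measurable_pair2.
Qed.

(** * Moments of the number of jumps *)

Section counting_path.
Context {R : realType} (n : cumulative R R).
Hypothesis n0 : n 0 = 0.
Hypothesis jump : forall t, 0 < t <= 1 ->
  (n x @[x --> t^'-] --> n t) \/ (n x @[x --> t^'-] --> n t - 1).
Local Notation LS := (lebesgue_stieltjes_measure n).

Let n_ge0 t : 0 <= t -> 0 <= n t.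
Proof. by move=> t0; rewrite -n0; exact: cumulative_is_nondecreasing. Qed.

Let mn (D : set (measurableTypeR R)) : measurable D -> measurable_fun D n.
Proof.
by move=> mD; apply: nondecreasing_measurable => //;
  exact: cumulative_is_nondecreasing.
Qed.

(** Along the grid the path tends to $N_{t-}$, which is $N_t$ or $N_t-1$. The lower limit is used
    because Fatou's lemma is what follows. *)
Lemma le_grid_jump t : 0 < t <= 1 ->
  ((n t - 1)%:E <= limn_einf (fun k => (n (grid k t))%:E))%E.
Proof.
move=> t01; have t0 : 0 < t by case/andP: t01.
have key l : n x @[x --> t^'-] --> l ->
    limn_einf (fun k => (n (grid k t))%:E) = l%:E.
  move=> /(cvg_grid t0) nl.
  have nlE : (n (grid k t))%:E @[k --> \oo] --> l%:E.
    by apply: cvg_EFin => //; apply: nearW.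
  by rewrite (cvg_limn_einf_sup nlE).1.
by case: (jump t01) => /key ->; rewrite lee_fin ?lexx// gerBl.
Qed.

(** After the change of variable the integrand is $N(T(y))\ge y$. Keeping only the upper half
    $y>N_1/2$ of the range gives $(N_1/2)^2$; the loss against $N_1^2/2$ is harmless. *)
Lemma sqr_le_stieltjes :
  ((n 1 ^+ 2 / 4)%:E <= \int[LS]_(s in `]0%R, 1%R]) (n s)%:E)%E.
Proof.
have n1 : 0 <= n 1 by exact: n_ge0.
(* The change of variable asks for a function that is nonnegative on the whole line, and [n] may be
   negative before 0. *)
have -> : (\int[LS]_(s in `]0%R, 1%R]) (n s)%:E =
    \int[LS]_(s in `]0%R, 1%R]) (Num.max (n s) 0)%:E)%E.
  apply: eq_integral => s /set_mem; rewrite /= in_itv/= => /andP[s0 _].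
  by rewrite max_l// n_ge0// ltW.
rewrite (stieltjes_integral_ginv n0)//; last 2 first.
- by apply/measurable_EFinP; apply: measurable_maxr => //; exact: mn.
- by move=> s; rewrite lee_fin le_max lexx orbT.
rewrite n0.
have mg : measurable_fun setT
    (fun y : measurableTypeR R => (Num.max (n (ginv n y)) 0)%:E).
  apply/measurable_EFinP; apply: measurable_maxr => //.
  by apply: (measurableT_comp (mn measurableT)); exact: measurable_ginv1.
apply: (@le_trans _ _ (\int[lebesgue_measure]_(y in `](n 1 / 2)%R, (n 1)%R])
    (Num.max (n (ginv n y)) 0)%:E)%E); last first.
  apply: ge0_subset_integral => //.
  - exact: measurable_funTS.
  - by move=> y _; rewrite lee_fin le_max lexx orbT.
  - by apply: subset_itvr; rewrite bnd_simp divr_ge0.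
apply: (@le_trans _ _ (\int[lebesgue_measure]_(y in `](n 1 / 2)%R, (n 1)%R])
    (n 1 / 2)%:E)%E).
  rewrite integral_cst//= [X in (_ * X)%E]lebesgue_measure_itv/= lte_fin.
  case: ifPn => [_|]; first by rewrite -EFinB -EFinM lee_fin; lra.
  by rewrite -leNgt mule0 lee_fin; nra.
apply: ge0_le_integral => //.
- by move=> y _; rewrite lee_fin divr_ge0.
- exact: measurable_funTS.
move=> y; rewrite /= in_itv/= => /andP[y1 y2].
rewrite lee_fin le_max (le_trans (ltW y1))// le_cumulative_ginv//.
by rewrite y2 (le_lt_trans _ y1)// divr_ge0.
Qed.

(** An adapted counting process need not be predictable, but its values along the grid form a
    predictable process. Here $N\le (N-1)^++1$, the first summand lies below the lower limit of the
    grid values, and the 1 integrates to $N_1$. *)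
Lemma sqr_le_liminf : ((n 1 ^+ 2 / 4)%:E <=
  limn_einf (fun k => \int[LS]_(s in `]0%R, 1%R]) (n (grid k s))%:E) + (n 1)%:E)%E.
Proof.
have mgrid k (D : set (measurableTypeR R)) : measurable D ->
    measurable_fun D (fun s => (n (grid k s))%:E).
  move=> mD; apply/measurable_EFinP; apply: nondecreasing_measurable => // s t st.
  apply: cumulative_is_nondecreasing; rewrite /grid.
  have : (Num.ceil (k.+1%:R * s) - 1)%:~R / k.+1%:R <=
         (Num.ceil (k.+1%:R * t) - 1)%:~R / k.+1%:R :> R.
    rewrite ler_pM2r ?invr_gt0// ler_int lerD2r.
    by apply: ceil_le; rewrite ler_pM2l.
  by rewrite ge_max !le_max lexx/= => ->; rewrite orbT.
apply: (le_trans sqr_le_stieltjes).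
pose g s : \bar R := (Num.max (n s - 1) 0)%:E.
have mg : measurable_fun (`]0, 1]%classic : set (measurableTypeR R)) g.
  apply/measurable_EFinP; apply: measurable_maxr => //.
  by apply: measurable_funB => //; exact: mn.
apply: (@le_trans _ _ (\int[LS]_(s in `]0%R, 1%R]) (g s + 1))%E).
  apply: ge0_le_integral => //.
  - by move=> s; rewrite /= in_itv/= => /andP[s0 _]; rewrite lee_fin n_ge0// ltW.
  - by apply/measurable_EFinP; exact: mn.
  - exact: emeasurable_funD.
  - by move=> s _; rewrite /g -EFinD lee_fin -lerBlDr le_max lexx.
rewrite ge0_integralD//; last first.
  by move=> s _; rewrite lee_fin le_max lexx orbT.
rewrite integral_cst// mul1e [X in (_ + X)%E]stieltjes_ocitv// n0 subr0.
rewrite leeD2r//.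
apply: (@le_trans _ _ (\int[LS]_(s in `]0%R, 1%R])
    limn_einf (fun k => (n (grid k s))%:E))%E); last first.
  apply: fatou => //; first by move=> k; exact: mgrid.
  by move=> k s _; rewrite lee_fin n_ge0// grid_ge0.
apply: ge0_le_integral => //.
- by move=> s _; rewrite lee_fin le_max lexx orbT.
- by apply: measurable_limn_einf => k; exact: mgrid.
move=> s; rewrite /= in_itv/= => s01; rewrite /g EFin_max ge_max le_grid_jump//=.
rewrite limn_einf_lim; apply: lime_ge; first exact: is_cvg_einfs.
apply: nearW => k; apply: le_ereal_inf_tmp => _ [j _ <-].
by rewrite lee_fin n_ge0// grid_ge0.
Qed.

End counting_path.

Section counting_moments.
Context {R : realType} d (S : measurableType d) (Q : probability S R).
Variables (H : R -> set (set S)) (N : S -> cumulative R R) (l : R -> S -> R).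
Variable C : R.
Hypothesis C0 : 0 <= C.
Hypothesis Hsig : forall t, 0 <= t <= 1 -> sigma_algebra setT (H t).
Hypothesis Hsub : forall t, 0 <= t <= 1 -> H t `<=` measurable.
Hypothesis Hmono : forall s t, 0 <= s -> s <= t -> t <= 1 -> H s `<=` H t.
Hypothesis hN : counting_process N.
Hypothesis aN : adapted H (path_process N).
Hypothesis hl : is_intensity Q H N l.
Hypothesis lC : {ae Q, forall w, forall t : R, 0 <= t <= 1 -> l t w <= C}.

Local Notation PT := (g_sigma_algebraType (predictable_sigma H)).
Local Notation TR := (measurableTypeR R).

Lemma adapted_measurable (Y : R -> S -> R) t : adapted H Y -> 0 <= t <= 1 ->
  measurable_fun setT (Y t).
Proof.
by move=> aY t01 _ B mB; rewrite setTI; apply: (Hsub t01); exact: aY.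
Qed.

Let mN t : 0 <= t <= 1 -> measurable_fun setT (fun w => N w t).
Proof. exact: (adapted_measurable aN). Qed.

Let N0 w : N w 0 = 0 := counting0 hN w.

Let N_ge0 w t : 0 <= t -> 0 <= N w t.
Proof. by move=> t0; rewrite -(N0 w); exact: cumulative_is_nondecreasing. Qed.

Let i11 : 0 <= (1 : R) <= 1. Proof. by rewrite lexx ler01. Qed.

Lemma counting_first_moment : (\int[Q]_w (N w 1)%:E <= C%:E)%E.
Proof.
have := le_stieltjes_predictable C0 Hsig Hsub Hmono N0 mN hl lC
  (f := cst 1%E) (fun _ => lee01) (@measurable_cst _ _ _ _ _ _).
under eq_integral do rewrite integral_cst//= mul1e stieltjes_ocitv// N0 subr0.
move=> /le_trans; apply.
under eq_integral do rewrite integral_cst//= mul1e lebesgue_measure_itv/= lte_fin ltr01 sube0.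
by rewrite integral_cst// mul1e [X in (_ * X)%E](@probability_setT _ _ _ Q) mule1.
Qed.

(** The factor 4 undoes the 1/4 of [sqr_le_liminf]. The term $C^2$ bounds the mean $dN$-integral of
    the grid values, by $C\,E N_1$ and then the first moment; the term $C$ bounds $E N_1$ itself. *)
Lemma counting_second_moment :
  (\int[Q]_w (N w 1 ^+ 2)%:E <= (4 * (C ^+ 2 + C))%:E)%E.
Proof.
pose f k (p : R * S) : \bar R := (N p.2 (grid k p.1))%:E.
have f0 k p : (0 <= f k p)%E by rewrite lee_fin N_ge0// grid_ge0.
have pf k : measurable_fun (time_strip (S := S) : set PT) (f k : PT -> \bar R).
  have := (predictableP H (fun t w => N w (grid k t))).1 (predictable_grid k aN).
  by move/measurable_EFinP.
have mf k : measurable_fun (time_strip (S := S) : set (TR * S)) (f k).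
  have := predictable_measurable Hsub (predictable_grid k aN).
  by move/measurable_EFinP.
pose I k w := (\int[lebesgue_stieltjes_measure (N w)]_(s in `]0%R, 1%R]) f k (s, w))%E.
have I0 k w : (0 <= I k w)%E by apply: integral_ge0 => s _.
have mI k : measurable_fun setT (I k).
  apply: measurable_stieltjes_integral => //.
  apply: (measurable_funS _ _ (mf k)); first exact: measurable_time_strip.
  by rewrite time_strip_set; exact: subsetUr.
have mN1 : measurable_fun setT (fun w => (N w 1)%:E) by apply/measurable_EFinP; exact: mN.
have IC k : (\int[Q]_w I k w <= (C ^+ 2)%:E)%E.
  apply: le_trans (le_stieltjes_predictable C0 Hsig Hsub Hmono N0 mN hl lC (f0 k) (pf k)) _.
  rewrite expr2 EFinM lee_wpmul2l ?lee_fin//.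
  apply: le_trans counting_first_moment.
  apply: ge0_le_integral => //.
  - by move=> w _; apply: integral_ge0.
  - by apply: (measurable_tonelli_rect lebesgue_measure).
  move=> w _.
  apply: (@le_trans _ _ (\int[lebesgue_measure]_(s in `[0%R, 1%R]) (N w 1)%:E)%E).
    apply: ge0_le_integral => //.
    + exact: (measurable_rect_section w _ (mf k)).
    + by move=> s; rewrite /= in_itv/= => s01; rewrite /f lee_fin;
        apply: cumulative_is_nondecreasing; case/andP: (grid_le1 k s01).
  rewrite integral_cst//= [X in (_ * X)%E]lebesgue_measure_itv/= lte_fin ltr01.
  by rewrite sube0 mule1.
have path w : ((N w 1 ^+ 2 / 4)%:E <= limn_einf (I ^~ w) + (N w 1)%:E)%E.
  exact: (sqr_le_liminf (N0 w) (fun t t01 => counting_jump hN w t01)).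
have mlim : measurable_fun setT (fun w => limn_einf (I ^~ w)) by exact: measurable_limn_einf.
have lim0 w : (0 <= limn_einf (I ^~ w))%E.
  rewrite limn_einf_lim; apply: lime_ge; first exact: is_cvg_einfs.
  by apply: nearW => k; apply: le_ereal_inf_tmp => _ [j _ <-].
have -> : (\int[Q]_w (N w 1 ^+ 2)%:E = 4%:E * \int[Q]_w (N w 1 ^+ 2 / 4)%:E)%E.
  rewrite -ge0_integralZl_EFin//; last 2 first.
  - by move=> w _; rewrite lee_fin divr_ge0// sqr_ge0.
  - apply/measurable_EFinP; apply: measurable_funM => //.
    by apply: measurable_funX; exact: mN.
  by apply: eq_integral => w _; rewrite -EFinM; congr EFin; lra.
rewrite EFinM lee_wpmul2l ?lee_fin//.
apply: (@le_trans _ _ (\int[Q]_w (limn_einf (I ^~ w) + (N w 1)%:E))%E).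
  apply: ge0_le_integral => //.
  - by move=> w _; rewrite lee_fin divr_ge0// sqr_ge0.
  - apply/measurable_EFinP; apply: measurable_funM => //.
    by apply: measurable_funX; exact: mN.
  - exact: emeasurable_funD.
rewrite ge0_integralD//; last by move=> w _; rewrite lee_fin N_ge0.
rewrite EFinD leeD ?counting_first_moment//.
apply: le_trans (fatou Q measurableT mI (fun k w _ => I0 k w)) _.
exact: le_limn_einf_cst.
Qed.

End counting_moments.

(** * Functions of i.i.d. observations *)

Section law.
Context d d' (T : measurableType d) (T' : measurableType d') (R : realType).
Variables (P : probability T R) (U : T -> T').
Hypothesis mU : measurable_fun setT U.

Definition law : probability T' R :=
  distribution P (mfun_Sub (mem_set mU) : {mfun T >-> T'}).

Lemma ge0_integral_law (f : T' -> \bar R) :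
  measurable_fun setT f -> (forall y, 0 <= f y)%E ->
  (\int[law]_y f y = \int[P]_x f (U x))%E.
Proof. by move=> mf f0; rewrite ge0_integral_distribution. Qed.

End law.

Section iid.
Context {R : realType} dO d (Om : measurableType dO) (S : measurableType d).
Variables (P : probability Om R) (Q : probability S R) (Z : nat -> Om -> S).
Hypothesis iid : iid_elements P Q Z.

Let mZ j : measurable_fun setT (Z j). Proof. by case: iid. Qed.

Let mZP j A : measurable A -> measurable (Z j @^-1` A).
Proof. by move=> mA; rewrite -[X in measurable X]setTI; exact: mZ. Qed.

Let ZQ j A : measurable A -> P (Z j @^-1` A) = Q A.
Proof. by case: iid => _ + _; apply. Qed.

Lemma iid_integral j (f : S -> \bar R) :
  measurable_fun setT f -> (forall s, 0 <= f s)%E ->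
  (\int[P]_w f (Z j w) = \int[Q]_s f s)%E.
Proof.
move=> mf f0; rewrite -(ge0_integral_law P (mZ j))//.
by apply: eq_measure_integral => A mA _; exact: (ZQ j mA).
Qed.

Lemma iid_ae j (p : S -> Prop) :
  {ae Q, forall s, p s} -> {ae P, forall w, p (Z j w)}.
Proof.
move=> [A [mA QA pA]]; exists (Z j @^-1` A); split; first exact: mZP.
  by rewrite ZQ.
by move=> w /= pw; exact: pA.
Qed.

(* The events [\bigcap_(j < m) (Z j @^-1` A j)] with [A k = setT] form a
   pi-system generating the sigma-algebra of the [Z j], [j != k]. *)
Definition cylinders_except (k : nat) : set (set Om) :=
  [set E | exists (m : nat) (A : nat -> set S),
    [/\ forall j, measurable (A j), A k = setT &
        E = \bigcap_(j in `I_m) (Z j @^-1` A j)]].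

(** Padding with [setT] brings two cylinders to the same number of coordinates. *)
Let widen m M (A : nat -> set S) : (m <= M)%N ->
  \bigcap_(j in `I_m) (Z j @^-1` A j) =
  \bigcap_(j in `I_M) (Z j @^-1` (if (j < m)%N then A j else setT)).
Proof.
move=> mM; apply/seteqP; split=> w AI j /= jM.
  by case: ifPn => // jm; exact: AI.
by have := AI j (leq_trans jM mM); rewrite /= jM.
Qed.

Lemma cylinders_exceptI k : setI_closed (cylinders_except k).
Proof.
move=> _ _ [m [A [mA Ak ->]]] [m' [A' [mA' A'k ->]]].
exists (maxn m m'), (fun j => (if (j < m)%N then A j else setT) `&`
                              (if (j < m')%N then A' j else setT)).
split.
- by move=> j; apply: measurableI; case: ifP.
- by rewrite Ak A'k; case: ifP; case: ifP; rewrite setIT.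
rewrite (widen _ (leq_maxl m m')) (widen A' (leq_maxr m m')).
by rewrite -bigcapI.
Qed.

Lemma cylinders_except_measurable k : cylinders_except k `<=` measurable.
Proof.
move=> _ [m [A [mA _ ->]]]; apply: fin_bigcap_measurable => // j _.
exact: mZP.
Qed.

Lemma cylinders_except_indep k E B : cylinders_except k E -> measurable B ->
  P (E `&` Z k @^-1` B) = (P E * Q B)%E.
Proof.
move=> [m [A [mA Ak ->]]] mB.
(* The range has to contain [k], so that the product formula shows a factor for it. *)
pose M := maxn m k.+1.
have kM : (k < M)%N by rewrite leq_maxr.
rewrite (widen _ (leq_maxl m k.+1)) -/M.
set A1 := fun j => if (j < m)%N then A j else setT.
have A1k : A1 k = setT by rewrite /A1 Ak; case: ifP.
have mA1 j : measurable (A1 j) by rewrite /A1; case: ifP.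
pose A2 j := if j == k then B else A1 j.
have mA2 j : measurable (A2 j) by rewrite /A2; case: ifP.
have -> : \bigcap_(j in `I_M) (Z j @^-1` A1 j) `&` Z k @^-1` B =
    \bigcap_(j in `I_M) (Z j @^-1` A2 j).
  apply/seteqP; split => [w [AI ZB] j jM|w AI].
    by rewrite /A2; case: eqP => [->//|_]; exact: AI.
  split=> [j jM|]; last by have := AI k kM; rewrite /A2 eqxx.
  have := AI j jM; rewrite /A2; case: eqP => // -> _.
  by rewrite A1k.
have [_ _ prodP] := iid.
rewrite (prodP M A1 mA1) (prodP M A2 mA2).
rewrite (bigD1 (Ordinal kM))//= [in RHS](bigD1 (Ordinal kM))//=.
rewrite A1k preimage_setT probability_setT mul1e /A2 eqxx ZQ// muleC.
congr (_ * _)%E; apply: eq_bigr => j jk.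
by rewrite ifF//; apply/negbTE; apply: contraNN jk => /eqP jk; apply/eqP/val_inj.
Qed.

(** As functions of [E] both sides are finite measures, and they agree on the pi-system of
    cylinders. *)
Lemma sigma_except_indep k E B : <<s cylinders_except k >> E -> measurable B ->
  P (E `&` Z k @^-1` B) = (P E * Q B)%E.
Proof.
move=> sE mB.
have QB : Q B = (fine (Q B))%:E by rewrite fineK// fin_num_measure.
have QB0 : 0 <= fine (Q B) by rewrite fine_ge0.
pose m1 : {measure set Om -> \bar R} := mrestr P (mZP k mB).
pose m2 : {measure set Om -> \bar R} := mscale (NngNum QB0) P.
have m2E A : m2 A = (P A * Q B)%E by rewrite QB muleC.
rewrite -m2E -[LHS]/(m1 E).
apply: (@g_sigma_algebra_measure_unique _ _ _ (cylinders_except k)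
  (@cylinders_except_measurable k) (fun=> setT) _ _ m1 m2) => //.
- move=> _; exists 0%N, (fun=> setT); split => //.
  by rewrite II0 bigcap_set0.
- by rewrite bigcup_const.
- exact: cylinders_exceptI.
- by move=> A cA; rewrite m2E; exact: cylinders_except_indep.
- move=> _; rewrite /m1/= /mrestr setTI ZQ//.
  by rewrite (le_lt_trans (probability_le1 Q mB))// ltry.
Qed.

(** As [U] depends only on observations other than [Z k], the law of the pair is a product. In this
    form conditioning on the training data enters, with no conditional expectation involved. *)
Lemma iid_tonelli k d' (T' : measurableType d') (U : Om -> T')
    (mU : measurable_fun setT U) (f : T' * S -> \bar R) :
  (forall A, measurable A -> <<s cylinders_except k >> (U @^-1` A)) ->
  measurable_fun setT f -> (forall p, 0 <= f p)%E ->
  (\int[P]_w f (U w, Z k w) = \int[law P mU]_x \int[Q]_s f (x, s))%E.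
Proof.
move=> sU mf f0.
have mUZ : measurable_fun setT (fun w => (U w, Z k w)).
  exact: measurable_fun_pair.
rewrite -(ge0_integral_law P mUZ)// -fubini_tonelli1//.
apply: eq_measure_integral => E mE _.
apply/esym/product_measure_unique => // A B mA mB.
exact: (sigma_except_indep (sU A mA) mB).
Qed.

Lemma sigma_except_other j k A : j != k -> measurable A ->
  <<s cylinders_except k >> (Z j @^-1` A).
Proof.
move=> jk mA; apply: sub_sigma_algebra.
exists j.+1, (fun i => if i == j then A else setT); split.
- by move=> i; case: ifP.
- by rewrite eq_sym (negbTE jk).
apply/seteqP; split => [w ZA i _ /=|w /(_ j)/=]; first by case: eqP => // ->.
by rewrite eqxx; exact.
Qed.

Lemma measurable_training n (J : {set 'I_n}) :
  measurable_fun setT (training Z J).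
Proof.
apply/measurable_fun_tnthP => i.
rewrite (_ : _ \o _ = Z (enum_val i).+1)//.
by apply/funext => w; rewrite /= /training tnth_mktuple.
Qed.

Lemma training_sigma_except n (J : {set 'I_n}) k A :
  (forall i : 'I_n, i \in ~: J -> i.+1 != k) -> measurable A ->
  <<s cylinders_except k >> (training Z J @^-1` A).
Proof.
move=> Jk; move: A.
have [s0 sC sU] := smallest_sigma_algebra setT (cylinders_except k).
apply: (@smallest_sub _ _ _
  [set A | <<s cylinders_except k >> (training Z J @^-1` A)]).
  split.
  - by rewrite /= preimage_set0.
  - by move=> A /= /sC; rewrite !setTD preimage_setC.
  - by move=> A sA; rewrite /= preimage_bigcup; exact: sU.
move=> A; rewrite -bigcup_seq/= => -[i _ [B mB <-]]/=.
rewrite setTI (_ : _ @^-1` _ = Z (enum_val i).+1 @^-1` B).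
  by apply: sigma_except_other => //; apply: Jk; exact: enum_valP.
by apply/funext => w; rewrite /preimage/= /training tnth_mktuple.
Qed.

End iid.

(** * Chebyshev's inequality for an empirical mean *)

Section iid_mean_deviation.
Context {R : realType} dO d (Om : measurableType dO) (S : measurableType d).
Variables (P : probability Om R) (Q : probability S R) (Z : nat -> Om -> S).
Hypothesis iid : iid_elements P Q Z.
Variables (Y : S -> R) (m K : R) (n : nat) (J : {set 'I_n}).
Hypothesis mY : measurable_fun setT Y.
Hypothesis Y0 : forall s, 0 <= Y s.
Hypothesis Ym : (\int[Q]_s (Y s)%:E = m%:E)%E.
Hypothesis YK : (\int[Q]_s (Y s ^+ 2)%:E <= K%:E)%E.
Local Notation p := (#|J|%:R : R).

Let mZ j : measurable_fun setT (Z j). Proof. by case: iid. Qed.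

Let m0 : 0 <= m.
Proof. by rewrite -lee_fin -Ym; apply: integral_ge0 => s _; rewrite lee_fin. Qed.

Let mYZ j : measurable_fun setT (fun w => Y (Z j w)).
Proof. exact: measurableT_comp. Qed.

Let mYE : measurable_fun setT (fun s => (Y s)%:E).
Proof. exact/measurable_EFinP. Qed.

Let Y0E s : [set: S] s -> (0 <= (Y s)%:E)%E.
Proof. by rewrite lee_fin. Qed.

Let EmY : (\int[Q]_s (m%:E * (Y s)%:E) = (m * m)%:E)%E.
Proof. by rewrite ge0_integralZl_EFin// Ym. Qed.

Let cross i j : i != j -> (\int[P]_w (Y (Z i w) * Y (Z j w))%:E = (m * m)%:E)%E.
Proof.
move=> ij.
rewrite (iid_tonelli iid (k := j) (mZ i)
  (f := fun q => (Y q.1 * Y q.2)%:E)); last 3 first.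
- by move=> A mA; exact: sigma_except_other.
- by apply/measurable_EFinP; apply: measurable_funM; exact: measurableT_comp.
- by move=> q; rewrite lee_fin mulr_ge0.
rewrite (_ : (fun x => _) = (fun x => m%:E * (Y x)%:E)%E); last first.
  apply/funext => x /=; under eq_integral do rewrite EFinM.
  by rewrite ge0_integralZl_EFin// Ym muleC.
rewrite ge0_integral_law//; last 2 first.
- by apply/measurable_EFinP; exact: measurable_funM.
- by move=> y; rewrite -EFinM lee_fin mulr_ge0.
rewrite (iid_integral iid i (f := fun y => (m%:E * (Y y)%:E)%E)).
- exact: EmY.
- by apply/measurable_EFinP; exact: measurable_funM.
- by move=> y; rewrite -EFinM lee_fin mulr_ge0.
Qed.

Let diag i : (\int[P]_w (Y (Z i w) * Y (Z i w))%:E <= K%:E)%E.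
Proof.
rewrite (iid_integral iid i (f := fun y => (Y y * Y y)%:E)).
- by under eq_integral do rewrite -expr2.
- by apply/measurable_EFinP; exact: measurable_funM.
- by move=> y; rewrite lee_fin mulr_ge0.
Qed.

Let T w := \sum_(j in J) Y (Z j.+1 w).

Let T0 w : 0 <= T w. Proof. exact: sumr_ge0. Qed.

Let mT : measurable_fun setT T.
Proof.
rewrite (_ : T = fun w => \sum_(j <- enum J) Y (Z j.+1 w)).
  exact: measurable_sum.
by apply/funext => w; rewrite /T big_enum.
Qed.

Let ET : (\int[P]_w (T w)%:E = (p * m)%:E)%E.
Proof.
under eq_integral do rewrite /T -sumEFin -big_enum/=.
rewrite ge0_integral_sum//; last 2 first.
- by move=> j; apply/measurable_EFinP; exact: mYZ.
- by move=> j w _; rewrite lee_fin.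
rewrite (eq_bigr (fun=> m%:E)) => [|j _]; last first.
  by rewrite (iid_integral iid j.+1 (f := fun y => (Y y)%:E)) ?Ym// => s; exact: Y0E.
by rewrite big_enum/= sumEFin sumr_const mulr_natl.
Qed.

(** In each of the [p] rows of the double sum the diagonal term is at most [K], and the fewer than
    [p] others equal $m^2$ by independence. *)
Let ET2 : (\int[P]_w (T w ^+ 2)%:E <= (p * (K + p * m ^+ 2))%:E)%E.
Proof.
have TE w : (T w ^+ 2)%:E =
    (\sum_(i <- enum J) \sum_(j <- enum J) (Y (Z i.+1 w) * Y (Z j.+1 w))%:E)%E.
  rewrite expr2 /T big_enum/= big_distrl/= -sumEFin.
  apply: eq_bigr => i _; rewrite big_enum/= big_distrr/= -sumEFin.
  by [].
under eq_integral do rewrite TE.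
have mYY i j : measurable_fun setT (fun w => (Y (Z i w) * Y (Z j w))%:E).
  by apply/measurable_EFinP; exact: measurable_funM.
have YY0 i j w : (0 <= (Y (Z i w) * Y (Z j w))%:E)%E.
  by rewrite lee_fin mulr_ge0.
rewrite ge0_integral_sum//; last 2 first.
- by move=> i; apply: emeasurable_sum => j.
- by move=> i w _; apply: sume_ge0 => j.
have -> : (p * (K + p * m ^+ 2))%:E =
    (\sum_(i <- enum J) (K + p * m ^+ 2)%:E)%E.
  by rewrite big_enum/= sumEFin sumr_const mulr_natl.
rewrite big_seq [leRHS]big_seq; apply: lee_sum => i; rewrite mem_enum => iJ.
rewrite ge0_integral_sum//.
rewrite big_enum/= (bigD1 i)//= EFinD leeD ?diag//.
rewrite (eq_bigr (fun=> (m * m)%:E)) => [|j /andP[_ ji]]; last first.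
  by rewrite cross// eqSS eq_sym.
rewrite sumEFin lee_fin sumr_const -[(m * m) *+ _]mulr_natl -expr2 ler_wpM2r ?sqr_ge0//.
by rewrite ler_nat subset_leq_card//; apply/fintype.subsetP => j /andP[].
Qed.

Lemma iid_mean_deviation (e : R) : 0 < e -> (0 < #|J|)%N ->
  (P [set w | (e <= `|p^-1 * (\sum_(j in J) Y (Z j.+1 w)) - m|)%R]
   <= (K / (p * e ^+ 2))%:E)%E.
Proof.
move=> e0 J0.
have p0 : 0 < p by rewrite ltr0n.
have c0 : 0 <= p * m by rewrite mulr_ge0// ltW.
pose g w := (T w - p * m) ^+ 2.
have mg : measurable_fun setT g.
  by apply: measurable_funX; exact: measurable_funB.
have Eg : (\int[P]_w (g w)%:E <= (p * K)%:E)%E.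
  (* The expansion of the square is written with its negative term moved to the other side, so that
     only integrals of nonnegative functions are added. *)
  have : (\int[P]_w (g w)%:E + (2 * (p * m) * (p * m))%:E =
      \int[P]_w (T w ^+ 2)%:E + ((p * m) ^+ 2)%:E)%E.
    have -> : (2 * (p * m) * (p * m))%:E =
        (\int[P]_w ((2 * (p * m))%:E * (T w)%:E))%E.
      rewrite ge0_integralZl_EFin ?ET//; last 3 first.
      - by move=> w _; rewrite lee_fin.
      - exact/measurable_EFinP.
      - by rewrite mulr_ge0.
    have -> : ((p * m) ^+ 2)%:E = (\int[P]_w ((p * m) ^+ 2)%:E)%E.
      by rewrite integral_cst//= [X in (_ * X)%E]probability_setT mule1.
    rewrite -!ge0_integralD//.
    - apply: eq_integral => w _; rewrite -EFinM -!EFinD; congr EFin.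
      by rewrite /g; ring.
    - by move=> w _; rewrite lee_fin sqr_ge0.
    - by apply/measurable_EFinP; exact: measurable_funX.
    - by move=> w _; rewrite lee_fin sqr_ge0.
    - by move=> w _; rewrite lee_fin sqr_ge0.
    - exact/measurable_EFinP.
    - by move=> w _; rewrite -EFinM lee_fin !mulr_ge0.
    - by apply/measurable_EFinP; exact: measurable_funM.
  move=> EE.
  have := leeD2r ((p * m) ^+ 2)%:E ET2; rewrite -EE -leeBrDr// => /le_trans; apply.
  by rewrite lee_fin; lra.
have pe : 0 < (p * e) ^+ 2 by rewrite exprn_gt0// mulr_gt0.
have := le_integral_abse P measurableT (g := EFin \o g)
  (iffRL (measurable_EFinP _ _) mg) pe.
rewrite setTI.
have gE w : g w = (p * `|p^-1 * T w - m|) ^+ 2.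
  rewrite exprMn real_normK ?num_real// -exprMn mulrBr mulrA divff ?gt_eqF//.
  by rewrite mul1r.
rewrite (_ : [set x | _] = [set w | e <= `|p^-1 * T w - m|]); last first.
  apply/seteqP; split => w /=; rewrite lee_fin (ger0_norm (sqr_ge0 _)) -/(g w) gE;
    by rewrite ler_pXn2r ?nnegrE ?mulr_ge0 ?(ltW p0) ?(ltW e0)// ler_pM2l.
under eq_integral do rewrite /= (ger0_norm (sqr_ge0 _)).
move=> /le_trans/(_ Eg).
rewrite -lee_pdivlMl// => /le_trans; apply.
rewrite -EFinM lee_fin.
rewrite le_eqVlt; apply/orP; left; apply/eqP; field.
by rewrite !gt_eqF.
Qed.

End iid_mean_deviation.

Lemma integral_rect_patch (R : realType) (S : Type) d (T : measurableType d)
    (mu : {measure set T -> \bar R}) (A D : set T) (g : T * S -> \bar R) (w : S) :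
  A `<=` D ->
  (\int[mu]_(s in D) (g \_ (A `*` setT)) (s, w) = \int[mu]_(s in A) g (s, w))%E.
Proof.
move=> AD; rewrite -[in RHS](setIidr AD) integral_mkcondr.
apply: eq_integral => s _; rewrite /patch.
by congr (if _ then _ else _); apply/idP/idP => /set_mem As; apply/mem_set;
  [case: As|split].
Qed.

(** * The truncated residual process and its variance function *)

Section truncated_residual.
Context {R : realType} d (S : measurableType d) (Q : probability S R).
Variables (H : R -> set (set S)) (N : S -> cumulative R R) (l G : R -> S -> R).
Variables C C' : R.
Hypothesis C0 : 0 <= C.
Hypothesis C'0 : 0 <= C'.
Hypothesis Hsig : forall t, 0 <= t <= 1 -> sigma_algebra setT (H t).
Hypothesis Hsub : forall t, 0 <= t <= 1 -> H t `<=` measurable.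
Hypothesis Hmono : forall s t, 0 <= s -> s <= t -> t <= 1 -> H s `<=` H t.
Hypothesis hN : counting_process N.
Hypothesis aN : adapted H (path_process N).
Hypothesis hl : is_intensity Q H N l.
Hypothesis lC : {ae Q, forall w, forall t : R, 0 <= t <= 1 -> l t w <= C}.
Hypothesis cG : caglad_process G.
Hypothesis aG : adapted H G.
Hypothesis GC : {ae Q, forall w, forall t : R, 0 <= t <= 1 -> `|G t w| <= C'}.

Local Notation PT := (g_sigma_algebraType (predictable_sigma H)).
Local Notation TR := (measurableTypeR R).
Local Notation strip := (time_strip (S := S)).

Let N0 w : N w 0 = 0 := counting0 hN w.

Let mN t : 0 <= t <= 1 -> measurable_fun setT (fun w => N w t).
Proof. exact: (adapted_measurable Hsub aN). Qed.

Let N_ge0 w t : 0 <= t -> 0 <= N w t.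
Proof. by move=> t0; rewrite -(N0 w); exact: cumulative_is_nondecreasing. Qed.

Definition clip (c x : R) : R := Num.max (- c) (Num.min c x).

Lemma clip_le c x : 0 <= c -> `|clip c x| <= c.
Proof.
by move=> c0; rewrite ler_norml /clip le_max lexx/= ge_max ge_min lexx andbT; lra.
Qed.

Lemma clip_id c x : `|x| <= c -> clip c x = x.
Proof. by rewrite ler_norml => /andP[cx xc]; rewrite /clip min_r// max_r. Qed.

Lemma predictable_residual : predictable H G.
Proof.
by apply: predictable_left_continuous => // w t t01; have [+ _] := cG w; exact.
Qed.

(** The bound holds on every path, not just almost every one, so each integral against $dN$ is
    finite; clipping also preserves predictability. *)
Definition clipped (t : R) (w : S) : R := clip C' (G t w).

Lemma predictable_clipped : predictable H clipped.
Proof.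
apply/predictableP; apply: measurable_maxr => //; apply: measurable_minr => //.
exact: (predictableP H G).1 predictable_residual.
Qed.

Definition sq_clipped (p : R * S) : \bar R := (clipped p.1 p.2 ^+ 2)%:E.

Lemma sq_clipped_ge0 p : (0 <= sq_clipped p)%E.
Proof. by rewrite lee_fin sqr_ge0. Qed.

Lemma sq_clipped_le p : (sq_clipped p <= (C' ^+ 2)%:E)%E.
Proof.
rewrite lee_fin -real_normK ?num_real// lerXn2r ?nnegrE//.
exact: clip_le.
Qed.

Lemma measurable_sq_clipped :
  measurable_fun (strip : set PT) (sq_clipped : PT -> \bar R).
Proof.
have := (predictableP H clipped).1 predictable_clipped.
by move=> /(measurable_funX 2)/measurable_EFinP.
Qed.

Lemma measurable_strip (f : R * S -> \bar R) :
  measurable_fun (strip : set PT) (f : PT -> \bar R) ->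
  measurable_fun (strip : set (TR * S)) (f : TR * S -> \bar R).
Proof.
move=> mf _ B mB; apply: (predictable_sigma_measurable Hsub).
have := predictable_sigma_setI (mf (@predictable_measurable_strip _ _ _ H) B mB).
by rewrite setIA setIid.
Qed.

Lemma measurable_strip_oc (f : TR * S -> \bar R) :
  measurable_fun (strip : set (TR * S)) f ->
  measurable_fun ((`]0, 1]%classic : set TR) `*` [set: S]) f.
Proof.
apply: measurable_funS; first exact: measurable_time_strip.
by rewrite time_strip_set; exact: subsetUr.
Qed.

Definition dN_sq (a b : R) (w : S) : \bar R :=
  (\int[lebesgue_stieltjes_measure (N w)]_(s in `]a, b]) sq_clipped (s, w))%E.

Lemma dN_sq_ge0 a b w : (0 <= dN_sq a b w)%E.
Proof. by apply: integral_ge0 => s _; exact: sq_clipped_ge0. Qed.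

Lemma measurable_dN_sq a b : 0 <= a -> a <= b -> b <= 1 ->
  measurable_fun setT (dN_sq a b).
Proof.
move=> a0 ab b1; apply: measurable_stieltjes_integral => //.
  by apply: measurable_strip_oc; apply: measurable_strip; exact: measurable_sq_clipped.
exact: sq_clipped_ge0.
Qed.

Let msec w : measurable_fun (`]0, 1]%classic : set TR) (fun s => sq_clipped (s, w)).
Proof.
apply: measurable_rect_section => //; apply: measurable_strip_oc.
by apply: measurable_strip; exact: measurable_sq_clipped.
Qed.

Let msec_sub w a b : 0 <= a -> b <= 1 ->
  measurable_fun (`]a, b]%classic : set TR) (fun s => sq_clipped (s, w)).
Proof.
move=> a0 b1; apply: measurable_funS (msec w) => //.
by apply: subset_itv; rewrite bnd_simp.
Qed.

Lemma dN_sq_le a b w : 0 <= a -> a <= b -> b <= 1 ->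
  (dN_sq a b w <= (C' ^+ 2 * (N w b - N w a))%:E)%E.
Proof.
move=> a0 ab b1; rewrite EFinM -(stieltjes_ocitv (N w) ab) -integral_cst//.
apply: ge0_le_integral => //.
- by move=> s _; exact: sq_clipped_ge0.
- exact: msec_sub.
- by move=> s _; exact: sq_clipped_le.
Qed.

Lemma dN_sqD a b w : 0 <= a -> a <= b -> b <= 1 ->
  dN_sq 0 b w = (dN_sq 0 a w + dN_sq a b w)%E.
Proof.
move=> a0 ab b1; rewrite /dN_sq.
rewrite (@itv_bndbnd_setU _ _ _ (BRight a)) ?bnd_simp//.
rewrite ge0_integral_setU//.
- rewrite -itv_bndbnd_setU ?bnd_simp//; exact: msec_sub.
- by move=> s _; exact: sq_clipped_ge0.
- apply/disj_setPS => s [/=]; rewrite !in_itv/= => /andP[_ sa] /andP[as_ _].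
  by move: as_; rewrite ltNge sa.
Qed.

Lemma dN_sq_fin a b w : 0 <= a -> a <= b -> b <= 1 -> dN_sq a b w \is a fin_num.
Proof.
move=> a0 ab b1; rewrite ge0_fin_numE ?dN_sq_ge0//.
by rewrite (le_lt_trans (dN_sq_le w a0 ab b1))// ltry.
Qed.

Definition sq_path (t : R) (w : S) : R := fine (dN_sq 0 t w).

Lemma sq_pathE t w : 0 <= t <= 1 -> (sq_path t w)%:E = dN_sq 0 t w.
Proof. by move=> /andP[t0 t1]; rewrite fineK// dN_sq_fin. Qed.

Lemma sq_path_ge0 t w : 0 <= sq_path t w.
Proof. by rewrite fine_ge0// dN_sq_ge0. Qed.

Lemma measurable_sq_path t : 0 <= t <= 1 -> measurable_fun setT (sq_path t).
Proof.
move=> /andP[t0 t1].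
by apply: measurableT_comp => //; exact: measurable_dN_sq.
Qed.

Lemma sq_path_nd s t w : 0 <= s -> s <= t -> t <= 1 -> sq_path s w <= sq_path t w.
Proof.
move=> s0 st t1; rewrite -lee_fin !sq_pathE ?s0 ?(le_trans st)//; last first.
  by rewrite (le_trans s0).
by rewrite (dN_sqD _ s0 st t1) leeDl// dN_sq_ge0.
Qed.

(** The path is at most $C'^2N_1$, whence the fourth power of [C'] in front of the second moment of
    $N_1$. *)
Lemma sq_path_second_moment t : 0 <= t <= 1 ->
  (\int[Q]_w (sq_path t w ^+ 2)%:E <=
   (C' ^+ 4 * (4 * (C ^+ 2 + C)))%:E)%E.
Proof.
move=> /[dup] t01 /andP[t0 t1].
apply: (@le_trans _ _ (\int[Q]_w ((C' ^+ 4)%:E * (N w 1 ^+ 2)%:E))%E).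
  apply: ge0_le_integral => //.
  - by move=> w _; rewrite lee_fin sqr_ge0.
  - by apply/measurable_EFinP; apply: measurable_funX; exact: measurable_sq_path.
  - apply/measurable_EFinP; apply: measurable_funM => //.
    by apply: measurable_funX; apply: mN; rewrite ler01 lexx.
  - move=> w _; rewrite -EFinM lee_fin.
    have : sq_path t w <= C' ^+ 2 * N w 1.
      rewrite -lee_fin sq_pathE//; apply: le_trans (dN_sq_le w (lexx 0) t0 t1) _.
      rewrite lee_fin N0 subr0 ler_wpM2l ?sqr_ge0//.
      exact: cumulative_is_nondecreasing.
    move=> sqN; have sqN2 : sq_path t w ^+ 2 <= (C' ^+ 2 * N w 1) ^+ 2.
      by apply: lerXn2r => //; rewrite nnegrE ?sq_path_ge0// mulr_ge0 ?sqr_ge0 ?N_ge0.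
    by apply: le_trans sqN2 _; rewrite le_eqVlt; apply/orP; left; apply/eqP; ring.
rewrite ge0_integralZl_EFin//; last 3 first.
- by move=> w _; rewrite lee_fin sqr_ge0.
- apply/measurable_EFinP; apply: measurable_funX.
  by apply: mN; rewrite ler01 lexx.
- by rewrite exprn_even_ge0.
rewrite [leRHS]EFinM lee_wpmul2l ?lee_fin ?exprn_even_ge0//.
exact: (counting_second_moment C0 Hsig Hsub Hmono hN aN hl lC).
Qed.

(** Multiplication by the indicator of the predictable rectangle ]a, b] x S reduces the claim to the
    inequality over the whole time interval. *)
Lemma integral_dN_sq_le a b : 0 <= a -> a <= b -> b <= 1 ->
  (\int[Q]_w dN_sq a b w <= (C * C' ^+ 2 * (b - a))%:E)%E.
Proof.
move=> a0 ab b1.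
pose E : set (R * S) := `]a, b]%classic `*` setT.
pose f := sq_clipped \_ E.
have f0 p : (0 <= f p)%E by rewrite /f /patch; case: ifP => // _; exact: sq_clipped_ge0.
have Estrip : E `<=` strip.
  move=> -[u w] [/=]; rewrite !in_itv/= => /andP[au ub] _; split => //=.
  by rewrite in_itv/= (le_trans a0 (ltW au)) (le_trans ub).
have mE : (measurable : set (set PT)) E.
  have [ab'|ba] := ltP a b; last first.
    by rewrite /E set_itv_ge ?set0X ?bnd_simp -?leNgt//; exact: measurable0.
  apply: sub_sigma_algebra; apply: sub_sigma_algebra; right.
  exists a, b, setT; split => //.
  have a01 : 0 <= a <= 1 by rewrite a0 (le_trans ab).
  by have [h0 hC _] := Hsig a01; rewrite -(setD0 setT); exact: hC.
have mf : measurable_fun (strip : set PT) (f : PT -> \bar R).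
  apply/(measurable_restrict _ mE (@predictable_measurable_strip _ _ _ H)).
  apply: measurable_funS measurable_sq_clipped.
    exact: predictable_measurable_strip.
  exact: subIsetl.
have := le_stieltjes_predictable C0 Hsig Hsub Hmono N0 mN hl lC f0 mf.
have -> : (\int[Q]_w \int[lebesgue_stieltjes_measure (N w)]_(s in `]0%R, 1%R]) f (s, w) =
   \int[Q]_w dN_sq a b w)%E.
  apply: eq_integral => w _; apply: (@integral_rect_patch _ _ _ TR) => s /=.
  by rewrite !in_itv/= => /andP[as_ sb]; rewrite (le_lt_trans a0 as_) (le_trans sb).
move=> /le_trans; apply.
rewrite -mulrA EFinM lee_wpmul2l ?lee_fin//.
apply: (@le_trans _ _ (\int[Q]_w (C' ^+ 2 * (b - a))%:E)%E); last first.
  by rewrite integral_cst//= [X in (_ * X)%E]probability_setT mule1.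
have mfs := measurable_strip mf.
apply: ge0_le_integral => //.
- by move=> w _; apply: integral_ge0.
- by apply: (measurable_tonelli_rect lebesgue_measure).
move=> w _.
rewrite (_ : (\int[_]_(s in _) _ =
  \int[lebesgue_measure]_(s in `]a, b]) sq_clipped (s, w))%E); last first.
  apply: (@integral_rect_patch _ _ _ TR) => s /=; rewrite !in_itv/=.
  by move=> /andP[as_ sb]; rewrite (le_trans a0 (ltW as_)) (le_trans sb).
apply: (@le_trans _ _ (\int[lebesgue_measure]_(s in `]a, b]) (C' ^+ 2)%:E)%E).
  apply: ge0_le_integral => //.
  - by move=> s _; exact: sq_clipped_ge0.
  - exact: msec_sub.
  - by move=> s _; exact: sq_clipped_le.
rewrite integral_cst//= [X in (_ * X)%E]lebesgue_measure_itv/= lte_fin.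
case: ifPn => [_|]; first by rewrite -EFinB -EFinM.
by rewrite -leNgt mule0 lee_fin => _; rewrite mulr_ge0 ?sqr_ge0// subr_ge0.
Qed.

Lemma variance_functionE t : 0 <= t <= 1 ->
  variance_function Q N G t = (\int[Q]_w dN_sq 0 t w)%E.
Proof.
move=> /andP[t0 t1].
have mG2 : measurable_fun (strip : set (TR * S)) (fun p => (G p.1 p.2 ^+ 2)%:E).
  have := predictable_measurable Hsub predictable_residual.
  by move=> /(measurable_funX 2)/measurable_EFinP.
apply: ge0_ae_eq_integral => //.
- have := @measurable_stieltjes_integral _ _ _ _ N0 mN _
    (measurable_strip_oc mG2) _ 0 t (lexx 0) t0 t1.
  by apply => p; rewrite lee_fin sqr_ge0.
- exact: measurable_dN_sq.
- by move=> w _; apply: integral_ge0 => s _; rewrite lee_fin sqr_ge0.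
- by move=> w _; exact: dN_sq_ge0.
apply: filterS GC => w Gw _; apply: eq_integral => s /set_mem/=.
rewrite in_itv/= => /andP[s0 st].
by rewrite /sq_clipped /clipped/= clip_id// Gw// (ltW s0) (le_trans st).
Qed.

Definition mean_sq (t : R) : R := fine (variance_function Q N G t).

Lemma mean_sqE t : 0 <= t <= 1 -> variance_function Q N G t = (mean_sq t)%:E.
Proof.
move=> /[dup] t01 /andP[t0 t1]; rewrite /mean_sq fineK//.
rewrite variance_functionE// ge0_fin_numE; last first.
  by apply: integral_ge0 => w _; exact: dN_sq_ge0.
by rewrite (le_lt_trans (integral_dN_sq_le (lexx 0) t0 t1))// ltry.
Qed.

Lemma mean_sq_path t : 0 <= t <= 1 -> (\int[Q]_w (sq_path t w)%:E = (mean_sq t)%:E)%E.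
Proof.
move=> t01; rewrite -mean_sqE// variance_functionE//.
by apply: eq_integral => w _; rewrite sq_pathE.
Qed.

Lemma mean_sq_increment s t : 0 <= s -> s <= t -> t <= 1 ->
  0 <= mean_sq t - mean_sq s <= C * C' ^+ 2 * (t - s).
Proof.
move=> s0 st t1.
have s01 : 0 <= s <= 1 by rewrite s0 (le_trans st).
have t01 : 0 <= t <= 1 by rewrite (le_trans s0).
have E : ((mean_sq t)%:E = (mean_sq s)%:E + \int[Q]_w dN_sq s t w)%E.
  rewrite -(mean_sqE t01) -(mean_sqE s01) (variance_functionE t01) (variance_functionE s01).
  under eq_integral do rewrite (dN_sqD _ s0 st t1).
  rewrite ge0_integralD//.
  - by move=> w _; exact: dN_sq_ge0.
  - by apply: measurable_dN_sq; case/andP: s01.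
  - by move=> w _; exact: dN_sq_ge0.
  - exact: measurable_dN_sq.
have I0 : (0 <= \int[Q]_w dN_sq s t w)%E by apply: integral_ge0 => w _; exact: dN_sq_ge0.
have IE : (\int[Q]_w dN_sq s t w = (mean_sq t - mean_sq s)%:E)%E.
  have sub (x y : R) (z : \bar R) : x%:E = (y%:E + z)%E -> z = (x - y)%:E.
    by case: z => [z| |]//= -[->]; rewrite addrAC subrr add0r.
  exact: sub E.
by rewrite -!lee_fin -IE I0 integral_dN_sq_le.
Qed.

End truncated_residual.

Lemma process_norm2_lt (R : realType) d (S : measurableType d)
    (P : probability S R) (W : R -> S -> R) (a : R) : 0 <= a ->
  (process_norm2 P W < a%:E)%E ->
  (\int[P]_w \int[lebesgue_measure]_(s in `[0%R, 1%R]) (W s w ^+ 2)%:E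
     <= (a ^+ 2)%:E)%E.
Proof.
move=> a0; rewrite /process_norm2; set I := (\int[P]_w _)%E.
have : (0 <= I)%E.
  by apply: integral_ge0 => w _; apply: integral_ge0 => s _; rewrite lee_fin sqr_ge0.
case: I => [r| |]//.
- rewrite lee_fin => r0; rewrite poweR_EFin powR12_sqrt// lte_fin lee_fin => ra.
  by rewrite -(sqr_sqrtr r0) lerXn2r ?nnegrE ?sqrtr_ge0// ltW.
- by rewrite poweRyr ?invr_eq0.
Qed.

(** * The error of the estimated residual process *)

Section estimator.
Context {R : realType} dO d (Om : measurableType dO) (S : measurableType d).
Variables (P : probability Om R) (Q : probability S R) (Z : nat -> Om -> S).
Variables (H : R -> set (set S)) (N : S -> cumulative R R) (l G : R -> S -> R).
Variables (C C' : R) (n : nat) (J : {set 'I_n}).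
Local Notation TS := (#|~: J|.-tuple S).
Variable ghat : TS -> R -> S -> R.
Hypothesis iid : iid_elements P Q Z.
Hypothesis C0 : 0 <= C.
Hypothesis C'0 : 0 <= C'.
Hypothesis Hsig : forall t, 0 <= t <= 1 -> sigma_algebra setT (H t).
Hypothesis Hsub : forall t, 0 <= t <= 1 -> H t `<=` measurable.
Hypothesis Hmono : forall s t, 0 <= s -> s <= t -> t <= 1 -> H s `<=` H t.
Hypothesis hN : counting_process N.
Hypothesis aN : adapted H (path_process N).
Hypothesis hl : is_intensity Q H N l.
Hypothesis lC : {ae Q, forall w, forall t : R, 0 <= t <= 1 -> l t w <= C}.
Hypothesis cG : caglad_process G.
Hypothesis aG : adapted H G.
Hypothesis GC : {ae Q, forall w, forall t : R, 0 <= t <= 1 -> `|G t w| <= C'}.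
Hypothesis hghat : predictable_estimator H ghat.
Hypothesis ghatC : {ae P, forall w, forall t : R, 0 <= t <= 1 ->
  `|evaluate Z ghat 0%N t w| <= C'}.

Local Notation PT := (g_sigma_algebraType (predictable_sigma H)).
Local Notation TR := (measurableTypeR R).
Local Notation strip2 := (time_strip (S := (TS * S)%type) : set (TR * (TS * S))).

Let mZ j : measurable_fun setT (Z j). Proof. by case: iid. Qed.

(** The path is lifted to pairs of training data and observation, so that integrals against $dN$
    become measurable in both arguments at once. *)
Let N2 (p : TS * S) := N p.2.

Let N20 p : N2 p 0 = 0. Proof. exact: (counting0 hN). Qed.

Let mN2 t : 0 <= t <= 1 -> measurable_fun setT (fun p => N2 p t).
Proof.
move=> t01; apply: (measurableT_comp (f := fun w => N w t)) => //.
exact: (adapted_measurable Hsub aN).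
Qed.

Lemma measurable_estimator : measurable_fun strip2 (fun q => ghat q.2.1 q.1 q.2.2).
Proof.
have [mg _] := hghat.
apply: (@measurable_comp _ _ _ _ _ _
  [set p : TS * R * S | 0 <= p.1.2 <= 1]
  (fun p => ghat p.1.1 p.1.2 p.2) strip2 (fun q => (q.2.1, q.1, q.2.2))) => //.
- have m12 : measurable_fun setT (fun p : TS * R * S => p.1.2) by exact: measurableT_comp.
  have := m12 measurableT `[0, 1]%classic (measurable_itv _).
  rewrite setTI (_ : _ @^-1` _ = [set p : TS * R * S | 0 <= p.1.2 <= 1])//.
- by move=> _ [q [/= q01 _] <-]; move: q01; rewrite in_itv.
- apply: measurable_funTS; apply: measurable_fun_pair; first apply: measurable_fun_pair.
  + exact: measurableT_comp.
  + exact: (@measurable_fst _ _ TR (TS * S)%type).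
  + exact: measurableT_comp.
Qed.

Let mlift (Y : R -> S -> R) : predictable H Y ->
  measurable_fun strip2 (fun q => Y q.1 q.2.2).
Proof.
move=> pY.
apply: (@measurable_comp _ _ _ _ _ _
  (time_strip (S := S) : set (TR * S)) (fun p => Y p.1 p.2) strip2
  (fun q => (q.1, q.2.2))) => //.
- exact: measurable_time_strip.
- by move=> _ [q [/= q01 _] <-].
- exact: (predictable_measurable Hsub pY).
- apply: measurable_funTS; apply: measurable_fun_pair => //.
  exact: measurableT_comp.
Qed.

Definition sq_error (q : R * (TS * S)) : R :=
  `|ghat q.2.1 q.1 q.2.2 ^+ 2 - clipped G C' q.1 q.2.2 ^+ 2|.

Let merr : measurable_fun strip2 (fun q => (sq_error q)%:E).
Proof.
apply/measurable_EFinP; apply: measurableT_comp => //.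
apply: measurable_funB; apply: measurable_funX.
  exact: measurable_estimator.
exact: (mlift (predictable_clipped C' cG aG)).
Qed.

Let err_ge0 q : (0 <= (sq_error q)%:E)%E.
Proof. by rewrite lee_fin normr_ge0. Qed.

Definition dN_error (p : TS * S) : \bar R :=
  (\int[lebesgue_stieltjes_measure (N p.2)]_(s in `]0%R, 1%R])
     (sq_error (s, p))%:E)%E.

Definition dt_error (p : TS * S) : \bar R :=
  (\int[lebesgue_measure]_(s in `[0%R, 1%R]) (sq_error (s, p))%:E)%E.

Let dN_error_ge0 p : (0 <= dN_error p)%E. Proof. exact: integral_ge0. Qed.
Let dt_error_ge0 p : (0 <= dt_error p)%E. Proof. exact: integral_ge0. Qed.

Let mdN_error : measurable_fun setT dN_error.
Proof.
exact: (measurable_stieltjes_integral (N := N2) N20 mN2 (measurable_strip_oc merr)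
  err_ge0 (lexx 0) ler01 (lexx 1)).
Qed.

Let mdt_error : measurable_fun setT dt_error.
Proof. exact: (measurable_tonelli_rect lebesgue_measure _ merr err_ge0). Qed.

Lemma predictable_sq_error x : measurable_fun (time_strip (S := S) : set PT)
  (fun p : PT => (sq_error (p.1, (x, p.2)))%:E).
Proof.
have m1 := (predictableP H (ghat x)).1 (hghat.2 x).
have m2 := (predictableP H _).1 (predictable_clipped C' cG aG).
have m3 := measurable_funB (measurable_funX 2 m1) (measurable_funX 2 m2).
have mn : measurable_fun [set: R] (fun x : R => `|x|) by exact: normr_measurable.
have := measurableT_comp mn m3.
by move/measurable_EFinP.
Qed.

(** For fixed training data the error is a predictable process on [S], to which the intensity
    inequality applies under [Q]. Both [Z k] and [Z 0] are independent of the training data, so both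
    outer means are integrals over the law of these data. *)
Lemma mean_dN_error_le k : (forall i : 'I_n, i \in ~: J -> i.+1 != k) ->
  (\int[P]_w dN_error (training Z J w, Z k w) <=
   C%:E * \int[P]_w dt_error (training Z J w, Z 0%N w))%E.
Proof.
move=> Jk.
have mtr := measurable_training iid (J := J).
have J0 (i : 'I_n) : i \in ~: J -> i.+1 != 0%N by [].
have E1 := iid_tonelli iid mtr (fun A mA => training_sigma_except Jk mA)
  mdN_error dN_error_ge0.
have E2 := iid_tonelli iid mtr (fun A mA => training_sigma_except J0 mA)
  mdt_error dt_error_ge0.
have m1 := @measurable_fun_fubini_tonelli_F _ _ _ _ _ Q _ mdN_error dN_error_ge0.
have m2 := @measurable_fun_fubini_tonelli_F _ _ _ _ _ Q _ mdt_error dt_error_ge0.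
rewrite /fubini_F in m1 m2.
rewrite E1 E2.
have I0 x : [set: TS] x -> (0 <= \int[Q]_s dt_error (x, s))%E.
  by move=> _; apply: integral_ge0 => s _; exact: dt_error_ge0.
rewrite -ge0_integralZl_EFin//.
apply: ge0_le_integral.
- exact: measurableT.
- by move=> x _; apply: integral_ge0 => s _; exact: dN_error_ge0.
- exact: m1.
- by apply: measurable_funeM; exact: m2.
move=> x _.
have N0 w : N w 0 = 0 := counting0 hN w.
have mN t : 0 <= t <= 1 -> measurable_fun setT (fun w => N w t).
  exact: (adapted_measurable Hsub aN).
exact: (le_stieltjes_predictable C0 Hsig Hsub Hmono N0 mN hl lC
  (fun p => err_ge0 (p.1, (x, p.2))) (predictable_sq_error x)).
Qed.

Let W t w := G t (Z 0%N w) - evaluate Z ghat 0%N t w.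

(** Pointwise $|y^2-x^2|\le 2C'|y-x|\le C'a+(C'/a)|y-x|^2$, and each summand has integral at most
    $C'a$. This stands in for the Cauchy-Schwarz inequality. *)
Lemma mean_dt_error_le (a : R) : 0 < a -> (process_norm2 P W < a%:E)%E ->
  (\int[P]_w dt_error (training Z J w, Z 0%N w) <= (2 * C' * a)%:E)%E.
Proof.
move=> a0 Wa.
have cst0 : 0 <= C' / a by rewrite divr_ge0// ltW.
have Ca0 : 0 <= C' * a by rewrite mulr_ge0// ltW.
have fin (K : Om -> \bar R) : measurable_fun setT K -> (forall w, 0 <= K w)%E ->
    (\int[P]_w K w <= (a ^+ 2)%:E)%E ->
    (\int[P]_w ((C' * a)%:E + (C' / a)%:E * K w) <= (2 * C' * a)%:E)%E.
  move=> mK K0 Ka.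
  rewrite ge0_integralD//; last 2 first.
  - by move=> w _; rewrite mule_ge0.
  - exact: measurable_funeM.
  rewrite integral_cst//= [X in (_ * X + _)%E]probability_setT mule1.
  rewrite ge0_integralZl_EFin//.
  have := lee_wpmul2l (x := (C' / a)%:E); rewrite lee_fin => /(_ cst0 _ _ Ka) le2.
  apply: le_trans (leeD2l _ le2) _.
  rewrite -EFinM -EFinD lee_fin le_eqVlt; apply/orP; left; apply/eqP; field.
  by rewrite gt_eqF.
pose sqW (q : R * (TS * S)) : \bar R := ((G q.1 q.2.2 - ghat q.2.1 q.1 q.2.2) ^+ 2)%:E.
have sqW0 q : (0 <= sqW q)%E by rewrite lee_fin sqr_ge0.
have msqW : measurable_fun strip2 sqW.
  apply/measurable_EFinP; apply: measurable_funX; apply: measurable_funB.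
    exact: (mlift (predictable_residual cG aG)).
  exact: measurable_estimator.
pose I2 p := (\int[lebesgue_measure]_(s in `[0%R, 1%R]) sqW (s, p))%E.
have mI2 : measurable_fun setT I2.
  exact: (measurable_tonelli_rect lebesgue_measure _ msqW sqW0).
have I20 p : (0 <= I2 p)%E by exact: integral_ge0.
have mpair : measurable_fun setT (fun w => (training Z J w, Z 0%N w)).
  by apply: measurable_fun_pair => //; exact: (measurable_training iid (J := J)).
have mI2w : measurable_fun setT (fun w => I2 (training Z J w, Z 0%N w)).
  exact: measurableT_comp.
apply: (@le_trans _ _ (\int[P]_w ((C' * a)%:E +
    (C' / a)%:E * I2 (training Z J w, Z 0%N w)))%E).
  apply: ae_ge0_le_integral => //.
  - exact: measurableT_comp.
  - by move=> w _; rewrite adde_ge0// ?lee_fin ?mulr_ge0 ?(ltW a0)// mule_ge0.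
  - by apply: emeasurable_funD => //; exact: measurable_funeM.
  have GZ := iid_ae iid 0%N GC.
  move: GZ ghatC; apply: filterS2 => w Gw gw _.
  have msec (f : R * (TS * S) -> \bar R) : measurable_fun strip2 f ->
      measurable_fun (`[0, 1]%classic : set TR)
        (fun s => f (s, (training Z J w, Z 0%N w))).
    by move=> mf; exact: (measurable_rect_section (T1 := TR) _ _ mf).
  rewrite /I2 -ge0_integralZl_EFin//; last exact: (msec sqW msqW).
  have -> : (C' * a)%:E = (\int[lebesgue_measure]_(s in `[0%R, 1%R]) (C' * a)%:E)%E.
    rewrite integral_cst//= [X in (_ * X)%E]lebesgue_measure_itv/= lte_fin ltr01.
    by rewrite sube0 mule1.
  rewrite -ge0_integralD//; last 2 first.
  - by move=> s _; rewrite mule_ge0.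
  - by apply: measurable_funeM; exact: (msec sqW msqW).
  apply: ge0_le_integral => //.
  - exact: (msec (fun q => (sq_error q)%:E) merr).
  - by apply: emeasurable_funD => //; apply: measurable_funeM; exact: (msec sqW msqW).
  move=> s; rewrite /= in_itv/= => s01.
  have := Gw s s01; have := gw s s01; rewrite /evaluate.
  rewrite /sqW /sq_error/= /clipped => gC GsC; rewrite (clip_id GsC).
  move: gC GsC; set x := G s _; set y := ghat _ _ _ => yC xC.
  rewrite -EFinM -EFinD lee_fin.
  have -> : y ^+ 2 - x ^+ 2 = (y - x) * (y + x) by ring.
  rewrite normrM.
  have yxC : `|y + x| <= 2 * C'.
    by rewrite (le_trans (ler_normD _ _))// mulr2n mulrDl !mul1r lerD.
  have -> : (x - y) ^+ 2 = `|y - x| ^+ 2 by rewrite real_normK ?num_real//; ring.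
  apply: (@le_trans _ _ (`|y - x| * (2 * C'))); first by rewrite ler_wpM2l.
  (* AM-GM: 2 |y - x| <= a + |y - x|^2 / a *)
  have : 0 <= C' / a * (`|y - x| - a) ^+ 2 by rewrite mulr_ge0// sqr_ge0.
  have -> : C' / a * (`|y - x| - a) ^+ 2 =
    C' / a * `|y - x| ^+ 2 - 2 * C' * `|y - x| + C' * a by field; rewrite gt_eqF.
  lra.
exact: (fin _ mI2w (fun w => I20 _) (process_norm2_lt (ltW a0) Wa)).
Qed.

Definition mean_dN_error (w : Om) : \bar R :=
  ((#|J|%:R^-1)%:E * \sum_(j in J) dN_error (training Z J w, Z j.+1 w))%E.

Let mdN_error_data j :
  measurable_fun setT (fun w => dN_error (training Z J w, Z j w)).
Proof.
apply: (measurableT_comp mdN_error).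
exact: (measurable_fun_pair (measurable_training iid (J := J)) (mZ j)).
Qed.

Lemma measurable_mean_dN_error : measurable_fun setT mean_dN_error.
Proof.
apply: measurable_funeM.
rewrite (_ : (fun w => _) =
  (fun w => \sum_(j <- enum J) dN_error (training Z J w, Z j.+1 w))%E).
  by apply: emeasurable_sum => j; exact: mdN_error_data.
by apply/funext => w; rewrite big_enum.
Qed.

Lemma mean_dN_error_ge0 w : (0 <= mean_dN_error w)%E.
Proof.
rewrite mule_ge0 ?lee_fin ?invr_ge0//.
by apply: sume_ge0 => j _; exact: dN_error_ge0.
Qed.

Lemma integral_mean_dN_error_le (a : R) : 0 < a -> (0 < #|J|)%N ->
  (process_norm2 P W < a%:E)%E ->
  (\int[P]_w mean_dN_error w <= (2 * C * C' * a)%:E)%E.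
Proof.
move=> a0 J0 Wa.
have e0 j w : (0 <= dN_error (training Z J w, Z j w))%E by exact: dN_error_ge0.
rewrite (_ : (fun w => _) = (fun w => (#|J|%:R^-1)%:E *
  \sum_(j <- enum J) dN_error (training Z J w, Z j.+1 w))%E); last first.
  by apply/funext => w; rewrite big_enum.
rewrite ge0_integralZl_EFin//; last 2 first.
- by move=> w _; apply: sume_ge0 => j _; exact: e0.
- by apply: emeasurable_sum => j; exact: mdN_error_data.
rewrite ge0_integral_sum; last 3 first.
- exact: measurableT.
- by move=> j; exact: mdN_error_data.
- by move=> j w _; exact: e0.
apply: (@le_trans _ _ ((#|J|%:R^-1)%:E * \sum_(j <- enum J) (2 * C * C' * a)%:E)%E).
  rewrite lee_wpmul2l ?lee_fin//.
  rewrite big_seq [leRHS]big_seq; apply: lee_sum => j; rewrite mem_enum => jJ.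
  apply: le_trans (mean_dN_error_le _) _.
    move=> i; rewrite finset.in_setC; apply: contraNN => /eqP[].
    by move=> /val_inj ->.
  rewrite (_ : 2 * C * C' * a = C * (2 * C' * a)); last by ring.
  by rewrite [leRHS]EFinM lee_wpmul2l ?lee_fin// mean_dt_error_le.
rewrite big_enum/= sumEFin sumr_const -[X in (_ * X%:E)%E]mulr_natl -EFinM lee_fin.
by rewrite mulrA mulVf ?mul1r// pnatr_eq0 -lt0n.
Qed.

End estimator.

(** Between neighbouring grid points $f(t)$ is squeezed by the two endpoint values of [f], while [v]
    changes by at most $L/(m+1)$. *)
Lemma monotone_grid_deviation (R : realType) (f v : R -> R) (L e : R) (m : nat) :
  (forall s t, 0 <= s -> s <= t -> t <= 1 -> f s <= f t) ->
  (forall s t, 0 <= s -> s <= t -> t <= 1 -> 0 <= v t - v s <= L * (t - s)) ->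
  0 <= L ->
  (forall i : nat, (i <= m.+1)%N -> `|f (i%:R / m.+1%:R) - v (i%:R / m.+1%:R)| < e) ->
  forall t, 0 <= t <= 1 -> `|f t - v t| < e + L / m.+1%:R.
Proof.
move=> fnd vL L0 fv t /andP[t0 t1].
set M : R := m.+1%:R; rewrite -/M in fv.
have M0 : 0 < M by rewrite /M.
pose i := Num.truncn (t * M).
have /andP[it ti] : i%:R <= t * M < i.+1%:R by apply: truncn_itv; rewrite mulr_ge0// ltW.
have im : (i <= m.+1)%N.
  by rewrite -(ler_nat R) (le_trans it)// ler_piMl// ltW.
have a0 : 0 <= i%:R / M by rewrite divr_ge0// ltW.
have at_ : i%:R / M <= t by rewrite ler_pdivrMr.
have a1 : i%:R / M <= 1 by rewrite (le_trans at_).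
have LM : 0 <= L / M by rewrite divr_ge0// ltW.
(* The index [m.+1] occurs only at [t = 1], itself a grid point; there is no right neighbour to
   use. *)
have [iM|iM] := ltnP i m.+1; last first.
  have iE : i = m.+1 by apply/eqP; rewrite eqn_leq im.
  have tE : t = i%:R / M.
    apply/eqP; rewrite eq_le at_ andbT (le_trans t1)//.
    by rewrite iE divff// gt_eqF.
  by rewrite tE (lt_le_trans (fv i im))// lerDl.
have b1 : i.+1%:R / M <= 1 by rewrite ler_pdivrMr// mul1r ler_nat.
have tb : t <= i.+1%:R / M by rewrite ler_pdivlMr// ltW.
have ba : i.+1%:R / M - i%:R / M = M^-1.
  by rewrite -mulrBl -natrB// subSnn mul1r.
have key (fa fb ft va vb vt d : R) : fa <= ft -> ft <= fb -> `|fa - va| < e ->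
    `|fb - vb| < e -> vt - va <= d -> vb - vt <= d -> `|ft - vt| < e + d.
  rewrite !ltr_norml => ? ? /andP[? ?] /andP[? ?] ? ?; apply/andP; split; lra.
apply: (key (f (i%:R / M)) (f (i.+1%:R / M)) _ (v (i%:R / M)) (v (i.+1%:R / M))).
- exact: fnd.
- exact: fnd.
- exact: fv.
- exact: fv.
- have /andP[_ /le_trans] := vL _ _ a0 at_ t1; apply.
  by rewrite ler_wpM2l// -[leRHS]ba lerD2r.
- have /andP[_ /le_trans] := vL _ _ t0 tb b1; apply.
  by rewrite ler_wpM2l// -[leRHS]ba lerD2l lerN2.
Qed.

(** * Uniform deviation of the variance estimator *)

Section sup_deviation.
Context {R : realType} dO d (Om : measurableType dO) (S : measurableType d).
Variables (P : probability Om R) (Q : probability S R) (Z : nat -> Om -> S).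
Variables (H : R -> set (set S)) (N : S -> cumulative R R) (l G : R -> S -> R).
Variables (C C' : R) (n : nat) (J : {set 'I_n}).
Local Notation TS := (#|~: J|.-tuple S).
Variable ghat : TS -> R -> S -> R.
Hypothesis iid : iid_elements P Q Z.
Hypothesis C0 : 0 <= C.
Hypothesis C'0 : 0 <= C'.
Hypothesis Hsig : forall t, 0 <= t <= 1 -> sigma_algebra setT (H t).
Hypothesis Hsub : forall t, 0 <= t <= 1 -> H t `<=` measurable.
Hypothesis Hmono : forall s t, 0 <= s -> s <= t -> t <= 1 -> H s `<=` H t.
Hypothesis hN : counting_process N.
Hypothesis aN : adapted H (path_process N).
Hypothesis hl : is_intensity Q H N l.
Hypothesis lC : {ae Q, forall w, forall t : R, 0 <= t <= 1 -> l t w <= C}.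
Hypothesis cG : caglad_process G.
Hypothesis aG : adapted H G.
Hypothesis GC : {ae Q, forall w, forall t : R, 0 <= t <= 1 -> `|G t w| <= C'}.
Hypothesis hghat : predictable_estimator H ghat.
Hypothesis ghatC : {ae P, forall w, forall t : R, 0 <= t <= 1 ->
  `|evaluate Z ghat 0%N t w| <= C'}.

Local Notation TR := (measurableTypeR R).
Local Notation VE := (variance_estimator Z N ghat).
Local Notation v := (mean_sq Q N G).
Local Notation A := (mean_dN_error Z N G C' ghat).

Let N0 w : N w 0 = 0 := counting0 hN w.

Let mN t : 0 <= t <= 1 -> measurable_fun setT (fun w => N w t).
Proof. exact: (adapted_measurable Hsub aN). Qed.

Let N_nd w s t : s <= t -> N w s <= N w t.
Proof. exact: cumulative_is_nondecreasing. Qed.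

Definition dN_sqhat (t : R) (p : TS * S) : \bar R :=
  (\int[lebesgue_stieltjes_measure (N p.2)]_(s in `]0%R, t])
    (ghat p.1 s p.2 ^+ 2)%:E)%E.

Let sqhat_sec p : measurable_fun (`]0, 1]%classic : set TR)
  (fun s => (ghat p.1 s p.2 ^+ 2)%:E).
Proof.
have := predictable_measurable Hsub (hghat.2 p.1).
move=> /(measurable_funX 2)/measurable_EFinP mg2.
exact: (measurable_rect_section (T1 := TR) p.2 _ (measurable_strip_oc mg2)).
Qed.

(** After the change of variable the range of integration is $]0,N_t]$, so time enters only through
    the number of jumps. *)
Lemma dN_sqhat_count t u p : 0 <= t -> t <= u -> u <= 1 ->
  N p.2 u = N p.2 t -> dN_sqhat u p = dN_sqhat t p.
Proof.
move=> t0 tu u1 Nut.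
have sub r : 0 <= r -> r <= 1 -> measurable_fun (`]0, r]%classic : set TR)
    (fun s => (ghat p.1 s p.2 ^+ 2)%:E).
  move=> r0 r1; apply: measurable_funS (sqhat_sec p) => //.
  by apply: subset_itv; rewrite bnd_simp.
have f0 s : (0 <= (ghat p.1 s p.2 ^+ 2)%:E)%E by rewrite lee_fin sqr_ge0.
have E r (r0 : 0 <= r) (r1 : r <= 1) := stieltjes_integral_ginv (N0 p.2)
  (lexx 0) r0 r1 (sub r r0 r1) f0.
by rewrite /dN_sqhat (E u (le_trans t0 tu) u1) (E t t0 (le_trans tu u1)) Nut.
Qed.

Lemma measurable_dN_sqhat t : 0 <= t -> t <= 1 -> measurable_fun setT (dN_sqhat t).
Proof.
move=> t0 t1.
have mN2 r : 0 <= r <= 1 -> measurable_fun setT (fun p : TS * S => N p.2 r).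
  by move=> r01; exact: (measurableT_comp (mN r01) measurable_snd).
have /(measurable_funX 2)/measurable_EFinP mg2 := measurable_estimator hghat.
apply: (measurable_stieltjes_integral (N := fun p : TS * S => N p.2)
  (fun p => N0 p.2) mN2 (measurable_strip_oc mg2) _ (lexx 0) t0 t1).
by move=> q; rewrite lee_fin sqr_ge0.
Qed.

Lemma variance_estimatorE t w : VE t w =
  ((#|J|%:R^-1)%:E * \sum_(j in J) dN_sqhat t (training Z J w, Z j.+1 w))%E.
Proof. by []. Qed.

Let msq (s : S) t : 0 <= t -> t <= 1 -> measurable_fun (`]0, t]%classic : set TR)
  (fun u => sq_clipped G C' (u, s)).
Proof.
move=> t0 t1.
have ms := measurable_strip Hsub (measurable_sq_clipped C' cG aG).
have := measurable_rect_section (T1 := TR) s (measurable_itv _) (measurable_strip_oc ms).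
by apply: measurable_funS => //; apply: subset_itv; rewrite bnd_simp.
Qed.

Let merr (p : TS * S) : measurable_fun (`]0, 1]%classic : set TR)
  (fun u => (sq_error G C' ghat (u, p))%:E).
Proof.
case: p => x s.
have me := measurable_strip Hsub (predictable_sq_error C' cG aG hghat x).
exact: (measurable_rect_section (T1 := TR) s (measurable_itv _) (measurable_strip_oc me)).
Qed.

Let merr_sub (p : TS * S) t : 0 <= t -> t <= 1 ->
  measurable_fun (`]0, t]%classic : set TR) (fun u => (sq_error G C' ghat (u, p))%:E).
Proof.
move=> t0 t1; apply: measurable_funS (merr p) => //.
by apply: subset_itv; rewrite bnd_simp.
Qed.

Let msqhat_sub (p : TS * S) t : 0 <= t -> t <= 1 ->
  measurable_fun (`]0, t]%classic : set TR) (fun u => (ghat p.1 u p.2 ^+ 2)%:E).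
Proof.
move=> t0 t1; apply: measurable_funS (sqhat_sec p) => //.
by apply: subset_itv; rewrite bnd_simp.
Qed.

Let err_ge0 q : (0 <= (sq_error G C' ghat q)%:E)%E.
Proof. by rewrite lee_fin normr_ge0. Qed.

(** Two additive bounds replace a bound on a difference, since the integral of the estimate may be
    infinite for this [p]. *)
Lemma dN_sqhat_near t (p : TS * S) : 0 <= t -> t <= 1 ->
  (dN_sqhat t p <= dN_error N G C' ghat p + dN_sq N G C' 0 t p.2 /\
   dN_sq N G C' 0 t p.2 <= dN_error N G C' ghat p + dN_sqhat t p)%E.
Proof.
move=> t0 t1.
have le_err : (\int[lebesgue_stieltjes_measure (N p.2)]_(u in `]0%R, t])
    (sq_error G C' ghat (u, p))%:E <= dN_error N G C' ghat p)%E.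
  apply: ge0_subset_integral => //.
  by apply: subset_itv; rewrite bnd_simp.
split.
- apply: le_trans (leeD2r _ le_err).
  rewrite /dN_sq -ge0_integralD//; last 3 first.
  + exact: (merr_sub p t0 t1).
  + by move=> u _; exact: sq_clipped_ge0.
  + exact: (msq p.2 t0 t1).
  apply: ge0_le_integral => //.
  + by move=> u _; rewrite lee_fin sqr_ge0.
  + exact: (msqhat_sub p t0 t1).
  + by apply: emeasurable_funD; [exact: (merr_sub p t0 t1)|exact: (msq p.2 t0 t1)].
  + move=> u _; rewrite /sq_clipped /sq_error/= -EFinD lee_fin.
    by rewrite -lerBlDr ler_norm.
- apply: le_trans (leeD2r _ le_err).
  rewrite /dN_sqhat -ge0_integralD//; last 3 first.
  + exact: (merr_sub p t0 t1).
  + by move=> u _; rewrite lee_fin sqr_ge0.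
  + exact: (msqhat_sub p t0 t1).
  apply: ge0_le_integral => //.
  + by move=> u _; exact: sq_clipped_ge0.
  + exact: (msq p.2 t0 t1).
  + by apply: emeasurable_funD; [exact: (merr_sub p t0 t1)|exact: (msqhat_sub p t0 t1)].
  + move=> u _; rewrite /sq_clipped /sq_error/= -EFinD lee_fin.
    by rewrite -lerBlDr distrC ler_norm.
Qed.

Let avg t w := (#|J|%:R)^-1 * \sum_(j in J) sq_path N G C' t (Z j.+1 w).

Lemma variance_estimator_near t w : 0 <= t <= 1 ->
  (VE t w <= A w + (avg t w)%:E /\ (avg t w)%:E <= A w + VE t w)%E.
Proof.
move=> /[dup] t01 /andP[t0 t1].
have J0 : (0 <= (#|J|%:R^-1 : R)%:E)%E by rewrite lee_fin invr_ge0.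
have avgE : (avg t w)%:E =
    ((#|J|%:R^-1)%:E * \sum_(j in J) dN_sq N G C' 0 t (Z j.+1 w))%E.
  rewrite /avg EFinM -sumEFin; congr (_ * _)%E; apply: eq_bigr => j _.
  exact: (sq_pathE N C'0 Hsub cG aG _ t01).
rewrite avgE variance_estimatorE /mean_dN_error.
have e0 (j : 'I_n) : (0 <= dN_error N G C' ghat (training Z J w, Z j.+1 w))%E.
  by apply: integral_ge0 => s _; exact: err_ge0.
have d0 (j : 'I_n) : (0 <= dN_sq N G C' 0 t (Z j.+1 w))%E by exact: dN_sq_ge0.
have h0 (j : 'I_n) : (0 <= dN_sqhat t (training Z J w, Z j.+1 w))%E.
  by apply: integral_ge0 => s _; rewrite lee_fin sqr_ge0.
rewrite -!ge0_muleDr ?sume_ge0// -!big_split/=.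
split; apply: lee_wpmul2l => //; apply: lee_sum => j _.
- by have [] := dN_sqhat_near (training Z J w, Z j.+1 w) t0 t1.
- by have [] := dN_sqhat_near (training Z J w, Z j.+1 w) t0 t1.
Qed.

Let VE_ge0 t w : (0 <= VE t w)%E.
Proof.
rewrite variance_estimatorE mule_ge0 ?lee_fin ?invr_ge0//.
apply: sume_ge0 => j _; apply: integral_ge0 => s _; rewrite lee_fin sqr_ge0//.
Qed.

Let V t := variance_function Q N G t.

Let VE' t : 0 <= t <= 1 -> V t = (v t)%:E.
Proof. exact: (mean_sqE C0 C'0 Hsig Hsub Hmono hN aN hl lC cG aG GC). Qed.

Let vL s t : 0 <= s -> s <= t -> t <= 1 -> 0 <= v t - v s <= C * C' ^+ 2 * (t - s).
Proof. exact: (mean_sq_increment C0 C'0 Hsig Hsub Hmono hN aN hl lC cG aG GC). Qed.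

Lemma deviation_le t w : 0 <= t <= 1 ->
  (`|VE t w - V t| <= A w + (`|avg t w - v t|)%:E)%E.
Proof.
move=> t01; have [] := variance_estimator_near w t01.
have := VE_ge0 t w; have : (0 <= A w)%E by exact: (mean_dN_error_ge0 Z N G C' ghat w).
rewrite (VE' t01); move: (VE t w) (A w) => x a.
(* An infinite error makes the claim trivial; a finite one forces the estimator to be finite, and
   real arithmetic suffices. *)
case: a => [a| |] //; last by move=> *; rewrite addye// leey.
case: x => [x| |]//.
rewrite -!EFinD !lee_fin => a0 x0 xa ax.
by rewrite ler_norml; move: (ler_norm (avg t w - v t)) (ler_norm (- (avg t w - v t)));
  rewrite normrN => ? ?; apply/andP; split; lra.
Qed.

Let mVE t : 0 <= t <= 1 -> measurable_fun setT (VE t).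
Proof.
move=> /andP[t0 t1].
rewrite (_ : VE t = fun w => ((#|J|%:R^-1)%:E *
    \sum_(j <- enum J) dN_sqhat t (training Z J w, Z j.+1 w))%E); last first.
  by apply/funext => w; rewrite variance_estimatorE big_enum.
apply: measurable_funeM; apply: emeasurable_sum => j.
apply: (measurableT_comp (measurable_dN_sqhat t0 t1)).
by case: iid => mZ _ _; exact: (measurable_fun_pair (measurable_training iid (J := J)) (mZ _)).
Qed.

Let exceeds (e : R) t := [set w | (e%:E < `|VE t w - V t|)%E].

Let measurable_exceeds e t : 0 <= t <= 1 -> measurable (exceeds e t).
Proof.
move=> t01; rewrite /exceeds -[X in measurable X]setTI.
apply: emeasurable_fun_o_infty => //; apply: measurableT_comp => //.
by apply: emeasurable_funB => //; exact: mVE.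
Qed.

(* The paths [N] are right-continuous and integer-valued, hence constant just
   after [t]; the estimator depends on [t] only through these paths. *)
Lemma variance_estimator_right w t : 0 <= t -> t < 1 ->
  \forall u \near t^'+, forall q, t <= q <= u -> VE q w = VE t w.
Proof.
move=> t0 t1.
have step (j : 'I_n) : \forall u \near t^'+, N (Z j.+1 w) u = N (Z j.+1 w) t.
  have Nr := cumulative_is_right_continuous (N (Z j.+1 w)) t.
  have : \forall u \near t^'+, N (Z j.+1 w) u < N (Z j.+1 w) t + 1.
    by apply: (cvgr_lt _ Nr); rewrite ltrDl.
  move=> Nlt; near=> u.
  have tu : t < u by near: u; exact: nbhs_right_gt.
  have u1 : u <= 1 by near: u; exact: nbhs_right_le.
  have ult : N (Z j.+1 w) u < N (Z j.+1 w) t + 1 by near: u.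
  have u01 : 0 <= u <= 1 by rewrite (le_trans t0 (ltW tu)).
  have t01 : 0 <= t <= 1 by rewrite t0 ltW.
  have ge := N_nd (Z j.+1 w) (ltW tu).
  have [k kE] := counting_nat hN (Z j.+1 w) u01.
  have [k' k'E] := counting_nat hN (Z j.+1 w) t01.
  move: ult ge; rewrite kE k'E natr1 ltr_nat ltnS ler_nat => kk' k'k.
  by congr (_%:R); apply/eqP; rewrite eqn_leq kk'.
have all_step := filter_forall _ step.
near=> u => q /andP[tq qu].
have u1 : u <= 1 by near: u; exact: nbhs_right_le.
have Nu : forall j : 'I_n, N (Z j.+1 w) u = N (Z j.+1 w) t by near: u; exact: all_step.
rewrite !variance_estimatorE; congr (_ * _)%E; apply: eq_bigr => j _.
apply: dN_sqhat_count => //=; first exact: le_trans u1.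
by apply/eqP; rewrite eq_le (N_nd _ tq) andbT -Nu N_nd.
Unshelve. all: by end_near. Qed.

(** A countable family of times in [0, 1]. It contains the endpoint 1, which cannot be approached
    from the right inside the interval. *)
Let time_of (q : rat) : R := if 0 <= (ratr q : R) <= 1 then ratr q else 1.

Let time_of01 q : 0 <= time_of q <= 1.
Proof. by rewrite /time_of; case: ifP => //; rewrite ler01 lexx. Qed.

(** A deviation above [e] at some [t < 1] persists at a rational just after [t]: the estimator has
    not moved yet, and the Lipschitz variance function has moved by less than the available gap. *)
Lemma exceedsP e : [set w | (e%:E < ereal_sup
    [set `|VE t w - V t| | t in `[0%R, 1%R]%classic])%E] =
  \bigcup_q exceeds e (time_of q).
Proof.
apply/seteqP; split=> [w /= /ereal_sup_gtP|w [q _ ew]]; last first.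
  apply/ereal_sup_gtP; exists (`|VE (time_of q) w - V (time_of q)|)%E => //.
  by exists (time_of q) => //=; rewrite in_itv/= time_of01.
case=> _ [t /= + <-] ew; rewrite in_itv/= => /[dup] t01 /andP[t0 t1].
move: t1; rewrite le_eqVlt => /predU1P[tE|t1].
  have T1 : time_of 1 = t by rewrite /time_of rmorph1 ler01 lexx.
  by exists 1; [exact: I|rewrite /exceeds T1].
pose L := C * C' ^+ 2.
have L0 : 0 <= L by rewrite mulr_ge0// sqr_ge0.
have [g g0 gap] : exists2 g : R, 0 < g & forall x : R, `|x - v t| < g ->
    (e%:E < `|VE t w - x%:E|)%E.
  move: ew; rewrite VE'//; have := VE_ge0 t w; case: (VE t w) => [r| |]//.
    rewrite lte_fin => _ er; exists (`|r - v t| - e); first by rewrite subr_gt0.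
    move=> x xg; rewrite lte_fin.
    have := ler_distD x r (v t); lra.
  by exists 1 => // x _; rewrite ltry.
have [u /andP[tu u1] [Ltu VEu]] : exists2 u, t < u < 1 & L * (u - t) < g /\
    forall q, t <= q <= u -> VE q w = VE t w.
  have near_u : \forall u \near t^'+, t < u < 1 /\ (L * (u - t) < g /\
      forall q, t <= q <= u -> VE q w = VE t w).
    near=> u; split; first (apply/andP; split); last split.
    - by near: u; exact: nbhs_right_gt.
    - by near: u; exact: nbhs_right_lt.
    (* Dividing by [L + 1] instead of [L] covers the case [L = 0]. *)
    - have ul : u < t + g / (L + 1).
        by near: u; apply: nbhs_right_lt; rewrite ltrDl divr_gt0// ltr_wpDl.
      have L1 : 0 < L + 1 by rewrite ltr_wpDl.
      have tu : t < u by near: u; exact: nbhs_right_gt.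
      have ug : (u - t) * (L + 1) < g by rewrite -ltr_pdivlMr// ltrBlDl.
      lra.
    - by near: u; exact: variance_estimator_right.
  by have [u [? ?]] := filter_ex near_u; exists u.
have [q] := rat_in_itvoo tu; rewrite in_itv/= => /andP[tq qu].
have q01 : 0 <= (ratr q : R) <= 1.
  by apply/andP; split; [exact: le_trans t0 (ltW tq)|exact: ltW (lt_trans qu u1)].
have Tq : time_of q = ratr q by rewrite /time_of q01.
exists q; first exact: I.
rewrite /exceeds Tq /= (VE' q01) (VEu _ (introT andP (conj (ltW tq) (ltW qu)))).
apply: gap; have /andP[v0 vq] := vL t0 (ltW tq) (proj2 (andP q01)).
rewrite ger0_norm// (le_lt_trans vq)// (le_lt_trans _ Ltu)//.
by rewrite ler_wpM2l// lerD2r ltW.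
Unshelve. all: by end_near. Qed.

Lemma measurable_exceeds_sup e : measurable [set w | (e%:E < ereal_sup
    [set `|VE t w - V t| | t in `[0%R, 1%R]%classic])%E].
Proof.
rewrite exceedsP; apply: bigcupT_measurable_rat => q.
exact: measurable_exceeds (time_of01 q).
Qed.

Let K := C' ^+ 4 * (4 * (C ^+ 2 + C)).

(** One third of [eps] each goes to the estimation error [A], to the deviation of the empirical mean
    at the grid points, and to the oscillation between them. The first summand is Markov's
    inequality for [A], the second Chebyshev's at each of the [m.+2] grid points. *)
Lemma sup_deviation_le (eps a : R) (m : nat) : 0 < eps -> 0 < a ->
  (process_norm2 P (fun t w => (G t (Z 0%N w) - evaluate Z ghat 0%N t w)%R) < a%:E)%E ->
  (0 < #|J|)%N -> C * C' ^+ 2 / m.+1%:R <= eps / 3 ->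
  (P [set w | (eps%:E < ereal_sup
    [set `|VE t w - V t| | t in `[0%R, 1%R]%classic])%E] <=
   (2 * C * C' * a / (eps / 3) +
    m.+2%:R * (K / (#|J|%:R * (eps / 3) ^+ 2)))%:E)%E.
Proof.
move=> eps0 a0 Wa J0 Lm.
set e := eps / 3; have e0 : 0 < e by rewrite divr_gt0.
have mavg t : 0 <= t <= 1 -> measurable_fun setT (avg t).
  move=> t01; rewrite /avg (_ : (fun w => _) = fun w =>
      #|J|%:R^-1 * \sum_(j <- enum J) sq_path N G C' t (Z j.+1 w)); last first.
    by apply/funext => w; rewrite big_enum.
  apply: measurable_funM; first exact: measurable_cst.
  apply: measurable_sum => j.
  apply: (measurableT_comp (measurable_sq_path C' Hsub hN aN cG aG t01)).
  by case: iid.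
pose B i := [set w | e <= `|avg (i%:R / m.+1%:R) w - v (i%:R / m.+1%:R)|].
(* Index 0 holds the event for [A] and the grid events are shifted by one, so that a single union
   bound covers them all. *)
pose B' i := if i is k.+1 then B k else [set w | (e%:E <= `|A w|)%E].
have grid01 i : (i < m.+2)%N -> 0 <= (i%:R / m.+1%:R : R) <= 1.
  by rewrite ltnS => im; rewrite divr_ge0//= ler_pdivrMr// mul1r ler_nat.
have mA : measurable_fun setT A :=
  measurable_mean_dN_error C' iid Hsub hN aN cG aG hghat.
have mB' k : (k < m.+3)%N -> measurable (B' k).
  case: k => [_|k]; rewrite /B'.
    rewrite -[X in measurable X]setTI; apply: emeasurable_fun_c_infty => //.
    exact: measurableT_comp.
  rewrite ltnS => km; rewrite /B -[X in measurable X]setTI.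
  have mdev : measurable_fun setT
      (fun w => `|avg (k%:R / m.+1%:R) w - v (k%:R / m.+1%:R)|).
    apply: (measurableT_comp (@normr_measurable _ setT)).
    by apply: (measurable_funB (mavg _ (grid01 k km))); exact: measurable_cst.
  by have := mdev measurableT _ (measurable_itv `[e, +oo[);
    congr (measurable (_ `&` _)); apply/seteqP; split => w /=; rewrite in_itv/= andbT.
have PB0 : (P (B' 0%N) <= (2 * C * C' * a / e)%:E)%E.
  have := @le_integral_abse _ _ _ P _ measurableT _ e mA e0; rewrite setTI.
  under eq_integral do rewrite (gee0_abs (mean_dN_error_ge0 Z N G C' ghat _)).
  move=> /le_trans/(_ (integral_mean_dN_error_le iid C0 C'0 Hsig Hsub Hmono hN aN hl
    lC cG aG GC hghat ghatC a0 J0 Wa)).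
  by rewrite -lee_pdivlMl// -EFinM mulrC.
have PB k : (k < m.+2)%N -> (P (B' k.+1) <= (K / (#|J|%:R * e ^+ 2))%:E)%E.
  move=> /grid01 t01.
  exact: (iid_mean_deviation iid (measurable_sq_path C' Hsub hN aN cG aG t01)
    (sq_path_ge0 N G C' _)
    (mean_sq_path C0 C'0 Hsig Hsub Hmono hN aN hl lC cG aG GC t01)
    (sq_path_second_moment C0 C'0 Hsig Hsub Hmono hN aN hl lC cG aG t01) e0 J0).
apply: (@le_trans _ _ (\sum_(k < m.+3) P (B' k))%E).
  apply: content_subadditive => //; first exact: measurable_exceeds_sup.
  move=> w /= ew; rewrite -bigcup_mkord.
  have [Ae|Ae] := leP e%:E (`|A w|)%E; first by exists 0%N.
  have [[k km Bk]|nB] := pselect (exists2 k, (k < m.+2)%N & B k w).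
    by exists k.+1.
  move: ew; apply: contraPP => _; apply/negP; rewrite -leNgt.
  apply: ge_ereal_sup => _ [t /= + <-]; rewrite in_itv/= => t01.
  apply: le_trans (deviation_le w t01) _.
  have near_v : `|avg t w - v t| < e + C * C' ^+ 2 / m.+1%:R.
    apply: (@monotone_grid_deviation _ (avg ^~ w)) => //.
    - move=> s u s0 su u1; rewrite ler_wpM2l ?invr_ge0//; apply: ler_sum => j _.
      exact: (sq_path_nd N C'0 Hsub cG aG _ s0 su u1).
    - by rewrite mulr_ge0 ?sqr_ge0.
    - by move=> i im; rewrite ltNge; apply/negP => Bi; apply: nB; exists i.
  move: Ae; rewrite (gee0_abs (mean_dN_error_ge0 Z N G C' ghat w)).
  have := mean_dN_error_ge0 Z N G C' ghat w; case: (A w) => [r| |]// _.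
  rewrite lte_fin -EFinD lee_fin => re; move: near_v re; rewrite /e.
  move: (C * _ / _) (`|_|) Lm => x y ? ? ?; lra.
rewrite big_ord_recl EFinD leeD//.
apply: (@le_trans _ _ (\sum_(k < m.+2) (K / (#|J|%:R * e ^+ 2))%:E)%E).
  by apply: lee_sum => k _; apply: PB.
by rewrite sumEFin lee_fin sumr_const card_ord [leRHS]mulr_natl.
Qed.

End sup_deviation.

(** * Suprema over the parameter set and choice of the constants *)

(** An inhabitant of [T] is required because the supremum of an empty range is $-\infty$. *)
Lemma cvg_ereal_sup_range0 (R : realType) (T : Type) (p : nat -> T -> \bar R) :
  (exists t : T, True) -> (forall n t, 0 <= p n t)%E ->
  (forall e : R, 0 < e -> \forall n \near \oo, forall t, (p n t <= e%:E)%E) ->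
  ereal_sup (range (p n)) @[n --> \oo] --> 0%E.
Proof.
move=> [t0 _] p0 pe.
have u0 n : (0 <= ereal_sup (range (p n)))%E.
  by apply: le_trans (p0 n t0) _; apply: ereal_sup_ubound; exists t0.
have ue e : 0 < e -> \forall n \near \oo, (ereal_sup (range (p n)) <= e%:E)%E.
  move=> /pe; apply: filterS => n pn.
  by apply: ge_ereal_sup => _ [t _ <-]; exact: pn.
apply/fine_cvgP; split.
  apply: filterS (ue 1 ltr01) => n un.
  by rewrite ge0_fin_numE// (le_lt_trans un)// ltry.
apply/cvgrPdist_le => e e0; apply: filterS (ue e e0) => n un /=.
rewrite sub0r normrN ger0_norm ?fine_ge0//.
by rewrite -lee_fin fineK// ge0_fin_numE// (le_lt_trans un)// ltry.
Qed.

Lemma cvge_lt (R : realType) (u : nat -> \bar R) (x y : \bar R) :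
  u n @[n --> \oo] --> x -> (x < y)%E -> \forall n \near \oo, (u n < y)%E.
Proof. by move=> ux xy; exact: ux _ (open_ereal_lt' xy). Qed.

Lemma cvge_gt (R : realType) (u : nat -> \bar R) (x y : \bar R) :
  u n @[n --> \oo] --> x -> (y < x)%E -> \forall n \near \oo, (y < u n)%E.
Proof. by move=> ux xy; exact: ux _ (open_ereal_gt' xy). Qed.

Theorem proposition4p7 (R : realType) (Theta : Type)
  (dS dO : measure_display)
  (S : Theta -> measurableType dS)
  (Q : forall th, probability (S th) R)
  (F : forall th, R -> set (set (S th)))
  (N : forall th, S th -> cumulative R R)
  (X : forall th, R -> S th -> R)
  (lambda blambda G : forall th, R -> S th -> R)
  (Om : Theta -> measurableType dO)
  (P : forall th, probability (Om th) R)
  (Z : forall th, nat -> Om th -> S th)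
  (J : forall n, {set 'I_n})
  (lhat ghat : forall th n, #|~: J n|.-tuple (S th) -> R -> S th -> R)
  (C C' : R)
  (hF : forall th, usual_filtration (Q th) (F th))
  (hN : forall th, counting_process (N th))
  (hNF : forall th, adapted (F th) (path_process (N th)))
  (hX : forall th, caglad_process (X th))
  (hXm : forall th (t : R), 0 <= t <= 1 -> measurable_fun setT (X th t))
  (hlambda : forall th, is_intensity (Q th) (F th) (N th) (lambda th))
  (hblambda : forall th,
    is_intensity (Q th) (enlarge (Q th) (F th) (X th)) (N th) (blambda th))
  (hG : forall th, residual_process (Q th) (F th) (X th) (G th))
  (hZ : forall th, iid_elements (P th) (Q th) (Z th))
  (hlhat : forall th n, predictable_estimator (F th) (lhat th n))
  (hghat : forall th n,
    predictable_estimator (enlarge (Q th) (F th) (X th)) (ghat th n))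
  (hC : 0 < C) (hC' : 0 < C')
  (hblambda_caglad : forall th, caglad_process (blambda th))
  (hblambda_bound : forall th,
    {ae Q th, forall w, forall t : R, 0 <= t <= 1 -> blambda th t w <= C})
  (hG_bound : forall th,
    {ae Q th, forall w, forall t : R, 0 <= t <= 1 -> `|G th t w| <= C'})
  (hlhat_bound : forall th n,
    {ae P th, forall w, forall t : R, 0 <= t <= 1 ->
      `|evaluate (Z th) (lhat th n) 0%N t w| <= C})
  (hghat_bound : forall th n,
    {ae P th, forall w, forall t : R, 0 <= t <= 1 ->
      `|evaluate (Z th) (ghat th n) 0%N t w| <= C'})
  (hJ : #|J n| @[n --> \oo] --> \oo)
  (hrates :
    let g th n := process_norm2 (P th)
      (fun t w => G th t (Z th 0%N w) - evaluate (Z th) (ghat th n) 0%N t w) in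
    let h th n := process_norm2 (P th)
      (fun t w => lambda th t (Z th 0%N w) - evaluate (Z th) (lhat th n) 0%N t w) in
    ereal_sup (range (fun th =>
      maxe (maxe (g th n) (h th n))
           ((Num.sqrt #|J n|%:R)%:E * g th n * h th n)%E))
      @[n --> \oo] --> 0%E) :
  forall eps : R, 0 < eps ->
    ereal_sup (range (fun th =>
      P th [set w |
        (eps%:E < ereal_sup
           [set `|variance_estimator (Z th) (N th) (ghat th n) t w
                  - variance_function (Q th) (N th) (G th) t| | t in `[0%R, 1%R]%classic])%E]))
      @[n --> \oo] --> 0%E.
Proof.
move=> eps eps0; cbv zeta in hrates.
have C0 : 0 <= C := ltW hC.
have C'0 : 0 <= C' := ltW hC'.
pose g th n := process_norm2 (P th)
  (fun t w => (G th t (Z th 0%N w) - evaluate (Z th) (ghat th n) 0%N t w)%R).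
have ubound_rate n th x : maxe (maxe (g th n) (process_norm2 (P th)
    (fun t w => (lambda th t (Z th 0%N w) - evaluate (Z th) (lhat th n) 0%N t w)%R))) x
    = maxe (g th n) (maxe (process_norm2 (P th)
    (fun t w => (lambda th t (Z th 0%N w) - evaluate (Z th) (lhat th n) 0%N t w)%R)) x).
  by rewrite maxA.
have g_small a : 0 < a -> \forall n \near \oo, forall th, (g th n < a%:E)%E.
  move=> a0.
  have a0E : (0 < a%:E)%E by rewrite lte_fin.
  have := cvge_lt hrates a0E; apply: filterS => n /= un th; apply: le_lt_trans un.
  apply: le_trans (ereal_sup_ubound _); last by exists th; [exact: I|reflexivity].
  by rewrite /= ubound_rate le_max lexx.
(* With [Theta] empty the suprema in [hrates] would all be $-\infty$ and could not tend to 0. *)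
have inhabited_Theta : exists th : Theta, True.
  apply: contrapT => empty.
  have : \forall n \near \oo, False.
    have := cvge_gt hrates (ltNyr 0); apply: filterS.
    by move=> n /ereal_sup_gtP[_ [th _ _] _]; apply: empty; exists th.
  by move=> /filter_ex[].
apply: cvg_ereal_sup_range0 => //.
move=> d d0.
pose e := eps / 3; have e0 : 0 < e by rewrite divr_gt0.
have [m Lm] : exists m : nat, C * C' ^+ 2 / m.+1%:R <= e.
  exists (Num.truncn (C * C' ^+ 2 / e)).
  by rewrite ler_pdivrMr// [leRHS]mulrC -ler_pdivrMr//; exact: ltW (truncnS_gt _).
pose K := C' ^+ 4 * (4 * (C ^+ 2 + C)).
(* [a] is chosen to make the Markov term equal to [d / 2]; [M] below is the size of [J n] from which
   the Chebyshev term is at most [d / 2]. *)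
pose a := d / 2 * e / (2 * C * C').
have a0 : 0 < a by rewrite divr_gt0 ?mulr_gt0// divr_gt0.
pose M := m.+2%:R * K / e ^+ 2 / (d / 2).
have J_large : \forall n \near \oo, (0 < #|J n|)%N /\ M <= #|J n|%:R.
  have := hJ.
  move=> /cvgnyPge/(_ (Num.truncn M).+1); apply: filterS => n Jn.
  split; first exact: leq_trans Jn.
  by rewrite (le_trans (ltW (truncnS_gt M)))// ler_nat.
apply: filterS2 J_large (g_small a a0) => n [J0 MJ] ga th.
have [cG aG _] := hG th.
have Hsig := @enlarge_sigma _ _ _ (Q th) (F th) (X th).
have Hsub := enlarge_measurable (hF th) (hXm th).
have Hmono := @enlarge_mono _ _ _ (Q th) (F th) (X th).
have aN : adapted (enlarge (Q th) (F th) (X th)) (path_process (N th)).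
  by move=> t t01 B mB; apply: (sub_enlarge (X th) (hF th) t01); exact: hNF.
apply: le_trans (sup_deviation_le (hZ th) C0 C'0 Hsig Hsub Hmono (hN th) aN
  (hblambda th) (hblambda_bound th) cG aG (hG_bound th) (hghat th n)
  (hghat_bound th n) eps0 a0 (ga th) J0 Lm) _.
rewrite lee_fin -/e -/K.
have -> : 2 * C * C' * a / e = d / 2.
  by rewrite /a; field; rewrite !gt_eqF.
have p0 : 0 < (#|J n|%:R : R) by rewrite ltr0n.
suff : m.+2%:R * (K / (#|J n|%:R * e ^+ 2)) <= d / 2 by lra.
have -> : m.+2%:R * (K / (#|J n|%:R * e ^+ 2)) = m.+2%:R * K / e ^+ 2 / #|J n|%:R.
  by field; rewrite !gt_eqF.
by rewrite ler_pdivrMr// [leRHS]mulrC -ler_pdivrMr// divr_gt0.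
Qed.
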